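(* Let $k\ge 3$ be a fixed integer. There is a randomized algorithm which, given any $2$-colorable $k$-uniform hypergraph $\mathcal H$ on the vertex set $\{1,\dots,n\}$, always outputs a proper $2$-coloring of $\mathcal H$, and such that the average, over all $2$-colorable $k$-uniform hypergraphs $\mathcal H$ on $\{1,\dots,n\}$, of its expected running time on $\mathcal H$ is $O(n)$.
   Context: A $k$-uniform hypergraph ($k$-graph) $\mathcal H$ consists of a vertex set and a set of $k$-element subsets of it (edges). A proper $2$-coloring is a map $c:V(\mathcal H)\to\{0,1\}$ with no monochromatic edge; $\mathcal H$ is $2$-colorable if it has one. For a randomized algorithm $A$, $T_A(\mathcal H)$ denotes its expected running time (over its internal randomness) on $\mathcal H$, and $T_A(n)$ is the average of $T_A(\mathcal H)$ over all $2$-colorable $k$-graphs on $\{1,\dots,n\}$ (uniform distribution). The algorithm accesses $\mathcal H$ via queries of the form ''is $(v_1,\dots,v_k)$ an edge of $\mathcal H$?''. Constants in $O(\cdot)$ may depend on $k$. *)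

(* Defs.v *)
From HB Require Import structures.
From mathcomp Require Import all_boot all_order all_algebra.
From mathcomp Require Import boolp classical_sets reals constructive_ereal.
From mathcomp Require Import ereal topology normedtype sequences.

Set Implicit Arguments.
Unset Strict Implicit.
Unset Printing Implicit Defensive.

Import Order.TTheory GRing.Theory Num.Theory.

(* The vertex set {1, .., n} is represented by 'I_n, and a hypergraph on it by
   its set of edges. *)
Definition kgraph (k n : nat) (H : {set {set 'I_n}}) : bool :=
  [forall e in H, #|e| == k].

Definition monochromatic (n : nat) (c : {ffun 'I_n -> bool}) (e : {set 'I_n}) :
  bool := [exists b : bool, forall v in e, c v == b].

Definition proper (n : nat) (H : {set {set 'I_n}}) (c : {ffun 'I_n -> bool}) :
  bool := [forall e in H, ~~ monochromatic c e].

Definition two_colorable (n : nat) (H : {set {set 'I_n}}) : bool :=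
  [exists c : {ffun 'I_n -> bool}, proper H c].

(* The answer to the query "is (v_1, .., v_k) an edge of H?".  It is negative
   if some v_i is not a vertex, and (H being k-uniform) if the v_i are not
   pairwise distinct. *)
Definition edge_query (n : nat) (H : {set {set 'I_n}}) (vs : seq nat) : bool :=
  all (fun v => v < n) vs && ([set v : 'I_n | (v : nat) \in vs] \in H).

(* The model of computation is the randomized word RAM, with programs in
   structured form: finitely many registers (those named by the program) and a
   memory of cells addressed by the content of registers, all holding words of
   O(log n) bits.  Every instruction takes one unit of time. *)
Inductive binop : Type := Add | Sub | Mul | Div | Mod | Eqb | Ltb.

Inductive cmd (k : nat) : Type :=
| Skip
| Const of nat & nat                 (* reg x := a                           *)
| Binop of binop & nat & nat & nat   (* reg x := reg y op reg z              *)
| Read of nat & nat                  (* reg x := mem (reg y)                 *)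
| Write of nat & nat                 (* mem (reg x) := reg y                 *)
| Rand of nat & nat                  (* reg x := uniform in [0, max 1 (reg y)) *)
| Query of nat & k.-tuple nat        (* reg x := is (reg y_1, .., reg y_k)   *)
                                     (*          an edge?                    *)
| Seq of cmd k & cmd k
| If of nat & cmd k & cmd k          (* test: reg x <> 0                     *)
| While of nat & cmd k.              (* test: reg x <> 0                     *)

Arguments Skip {k}.
Arguments Const {k}.
Arguments Binop {k}.
Arguments Read {k}.
Arguments Write {k}.
Arguments Rand {k}.

(* On inputs with n vertices words range over [0, (n + 2) ^ (word_exp + 1)),
   i.e., they have O(log n) bits. *)
Record algorithm (k : nat) : Type := Algorithm {
  code : cmd k;
  word_exp : nat
}.

Definition word_bound (k : nat) (A : algorithm k) (n : nat) : nat :=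
  n.+2 ^ (word_exp A).+1.

(* todo is the stack of commands that remain to be executed. *)
Record config (k : nat) : Type := Config {
  todo : seq (cmd k);
  reg : nat -> nat;
  mem : nat -> nat
}.

Definition upd (f : nat -> nat) (x a : nat) : nat -> nat :=
  fun y => if y == x then a else f y.

(* Sub is truncated at 0; division by 0 yields 0. *)
Definition eval_binop (W : nat) (op : binop) (a b : nat) : nat :=
  match op with
  | Add => (a + b) %% W
  | Sub => a - b
  | Mul => (a * b) %% W
  | Div => a %/ b
  | Mod => a %% b
  | Eqb => (a == b : nat)
  | Ltb => (a < b : nat)
  end.

Definition halted (k : nat) (s : config k) : bool := nilp (todo s).

(* The next step has (branching s) equally likely outcomes, and (step W Q s i)
   is the configuration reached under the i-th of them; W bounds the words and
   Q answers the queries. *)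
Definition branching (k : nat) (s : config k) : nat :=
  if todo s is Rand _ y :: _ then maxn 1 (reg s y) else 1.

Definition step (k W : nat) (Q : seq nat -> bool) (s : config k) (i : nat) :
  config k :=
  let: Config st r m := s in
  match st with
  | [::] => s
  | c :: st' =>
    match c with
    | Skip => Config st' r m
    | Const x a => Config st' (upd r x (a %% W)) m
    | Binop op x y z => Config st' (upd r x (eval_binop W op (r y) (r z))) m
    | Read x y => Config st' (upd r x (m (r y))) m
    | Write x y => Config st' r (upd m (r x) (r y))
    | Rand x _ => Config st' (upd r x i) m
    | Query x ys => Config st' (upd r x (Q [seq r y | y <- ys])) m
    | Seq c1 c2 => Config [:: c1, c2 & st'] r m
    | If x c1 c2 => Config ((if r x != 0 then c1 else c2) :: st') r m
    | While x c1 => Config (if r x != 0 then [:: c1, c & st'] else st') r m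
    end
  end.

(* Initially register 0 contains n and everything else is 0. *)
Definition init (k : nat) (A : algorithm k) (n : nat) : config k :=
  Config [:: code A] (upd (fun=> 0) 0 n) (fun=> 0).

(* The color of vertex v is read off memory cell v. *)
Definition output (k n : nat) (s : config k) : {ffun 'I_n -> bool} :=
  [ffun v : 'I_n => mem s v != 0].

(* Whatever the outcomes of the random choices, the computation from s halts,
   in a configuration that satisfies P. *)
Inductive always_halts_in (k W : nat) (Q : seq nat -> bool)
    (P : config k -> Prop) (s : config k) : Prop :=
| HaltsNow of halted s & P s
| HaltsLater of ~~ halted s &
    (forall i, i < branching s -> always_halts_in W Q P (step W Q s i)).

Definition always_correct (k : nat) (A : algorithm k) : Prop :=
  forall (n : nat) (H : {set {set 'I_n}}), kgraph k H -> two_colorable H ->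
  always_halts_in (word_bound A n) (edge_query H)
    (fun s => proper H (output n s)) (init A n).

Local Open Scope ring_scope.

(* The probability that the running time from s is exactly t. *)
Fixpoint time_prob (R : realType) (k W : nat) (Q : seq nat -> bool) (t : nat)
    (s : config k) : R :=
  match t with
  | 0%N => (halted s)%:R
  | t'.+1 => if halted s then 0 else
      \sum_(i < branching s)
        (branching s)%:R^-1 * time_prob R W Q t' (step W Q s i)
  end.

Local Open Scope ereal_scope.

(* The expectation of the [0, +oo]-valued running time: the second summand is
   +oo times the probability of not halting (with +oo * 0 = 0). *)
Definition expected_time (R : realType) (k : nat) (A : algorithm k) (n : nat)
    (H : {set {set 'I_n}}) : \bar R :=
  let p t := time_prob R (word_bound A n) (edge_query H) t (init A n) in
  \sum_(0 <= t <oo) (t%:R * p t)%:E + +oo * (1 - \sum_(0 <= t <oo) (p t)%:E).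

Definition average_time (R : realType) (k : nat) (A : algorithm k) (n : nat) :
  \bar R :=
  let colorable := [set H : {set {set 'I_n}} | kgraph k H && two_colorable H] in
  (\sum_(H in colorable) expected_time R A H) * (#|colorable|%:R^-1)%:E.

(* Main.v *)
From mathcomp Require Import all_boot all_order all_algebra.
From mathcomp Require Import reals constructive_ereal ereal topology normedtype sequences.
From mathcomp Require Import zify ring lra.
Require Import Defs.

(* The algorithm is deterministic.  A tuple of 2k vertices, split into halves X
   and Y, certifies a vertex v if all k-subsets meeting both X and Y are edges,
   if 0 forms an edge with k-1 vertices of Y, and if v forms an edge with k-1
   vertices of X or of Y.  In every proper 2-colouring X and Y are then
   monochromatic of opposite colours, 0 has the colour of X, and v has the colour
   of the half it does not form an edge with; so a certificate determines the
   colour of v relative to 0 and nothing has to be verified.  For each v the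
   algorithm tries first the disjoint blocks 1..2k, 2k+1..4k, ... of the first
   half of the vertices, then all tuples; if some v has no certificate it
   searches all colourings exhaustively.

   For the average, consider pairs of a colouring c and a hypergraph H without
   c-monochromatic edge.  Given c, H is uniformly random, so that families of
   tuples with disjoint sets of required edges fail independently.  A block is
   coloured suitably with constant probability, hence the j-th block is reached
   with probability exponentially small in j, and the expected number of tuples
   tried is O(1) per vertex.  If both colour classes are large, they contain
   order n^2 tuples pairwise sharing at most one vertex (lines in a grid); since
   k >= 3 their required edges are disjoint, so that the exhaustive search has
   probability exp(-c n^2), which outweighs its cost 2^n n^k.  A hypergraph on which
   all vertices have certificates has exactly two proper colourings, so that
   averaging over pairs and averaging over 2-colourable hypergraphs agree up to a
   constant factor. *)

Set Implicit Arguments.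
Unset Strict Implicit.
Unset Printing Implicit Defensive.

Import Order.TTheory GRing.Theory Num.Theory.

(** * Deterministic executions *)

Section Execution.
Variables (k W : nat) (Q : seq nat -> bool).
Implicit Types (c : cmd k) (r m : nat -> nat).

(** Demanding [branching s = 1] at each step makes the execution deterministic, so that a single run
    fixes the whole distribution of the running time. *)
Inductive reach : nat -> config k -> config k -> Prop :=
| Reach0 s : reach 0 s s
| ReachS t s s' : ~~ halted s -> branching s = 1 ->
    reach t (step W Q s 0) s' -> reach t.+1 s s'.

Lemma reach_trans t1 t2 s1 s2 s3 :
  reach t1 s1 s2 -> reach t2 s2 s3 -> reach (t1 + t2) s1 s3.
Proof.
elim=> [//|t s s' hs bs _ IH] /IH h.
by rewrite addSn; apply: ReachS.
Qed.

Lemma reach_always (P : config k -> Prop) t s s' :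
  reach t s s' -> halted s' -> P s' -> always_halts_in W Q P s.
Proof.
elim=> [{}s hs Ps|{}t {}s {}s' hs bs _ IH hs' Ps']; first exact: HaltsNow.
apply: HaltsLater => // i; rewrite bs ltnS leqn0 => /eqP->.
exact: IH.
Qed.

Lemma reach_time_prob (R : realType) t s s' u :
  reach t s s' -> halted s' -> time_prob R W Q u s = ((u == t)%:R)%R.
Proof.
move=> h; elim: h u => [{}s [|u] hs|{}t {}s {}s' hs bs _ IH [|u] hs'] /=.
- by rewrite hs.
- by rewrite hs.
- by rewrite (negbTE hs).
- rewrite (negbTE hs) bs big_ord_recl big_ord0 /= invr1 mul1r addr0.
  by rewrite IH // eqSS.
Qed.

(** A total-correctness triple with time budget [N]. The final state and the time are chosen before
    the remaining stack [st], which lets triples be chained. *)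
Definition runs c r m N (Phi : (nat -> nat) -> (nat -> nat) -> Prop) : Prop :=
  exists t r' m', [/\ t <= N, Phi r' m' &
    forall st, reach t (Config (c :: st) r m) (Config st r' m')].

Lemma runs_le c r m N N' Phi : N <= N' -> runs c r m N Phi -> runs c r m N' Phi.
Proof.
move=> le [t [r' [m' [tN ph h]]]]; exists t, r', m'; split=> //.
exact: leq_trans tN le.
Qed.

Lemma runs_post c r m N (Phi Psi : (nat -> nat) -> (nat -> nat) -> Prop) :
  (forall r m, Phi r m -> Psi r m) -> runs c r m N Phi -> runs c r m N Psi.
Proof.
move=> imp [t [r' [m' [tN ph h]]]]; exists t, r', m'; split=> //.
exact: imp.
Qed.

Lemma runs_seq c1 c2 r m N1 N2 Phi Psi :
  runs c1 r m N1 Psi ->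
  (forall r' m', Psi r' m' -> runs c2 r' m' N2 Phi) ->
  runs (Seq c1 c2) r m (N1 + N2).+1 Phi.
Proof.
move=> [t1 [r1 [m1 [le1 /[swap] h1 ps]]]] /(_ _ _ ps).
move=> [t2 [r2 [m2 [le2 ph h2]]]].
exists (t1 + t2).+1, r2, m2; split=> [|//|st]; first by rewrite ltnS leq_add.
by apply: ReachS => //=; apply: reach_trans (h1 _) (h2 _).
Qed.

Lemma runs_if x c1 c2 r m N Phi :
  runs (if r x != 0 then c1 else c2) r m N Phi ->
  runs (If x c1 c2) r m N.+1 Phi.
Proof.
move=> [t [r' [m' [le ph h]]]]; exists t.+1, r', m'; split=> // st.
by apply: ReachS => //=.
Qed.

(* [I B r m] is the loop invariant when [B] bounds the time still needed. *)
Lemma runs_while x c (I : nat -> (nat -> nat) -> (nat -> nat) -> Prop) Phi :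
  (forall B r m, I B r m -> r x = 0 -> 0 < B /\ Phi r m) ->
  (forall B r m, I B r m -> r x <> 0 ->
     exists N B', N + B' < B /\ runs c r m N (I B')) ->
  forall B r m, I B r m -> runs (While x c) r m B Phi.
Proof.
move=> hexit hbody B; have [n le_n] := ubnP B; elim: n B le_n => // n IH B le_n r m IB.
have [r0|/eqP r0] := eqVneq (r x) 0.
  have [B0 ph] := hexit _ _ _ IB r0.
  exists 1, r, m; split=> // st; apply: ReachS => //=; rewrite r0 /=.
  exact: Reach0.
have [N [B' [lt [t1 [r1 [m1 [le1 IB' h1]]]]]]] := hbody _ _ _ IB r0.
have [|t2 [r2 [m2 [le2 ph h2]]]] := IH B' _ r1 m1 IB'; first by lia.
exists (t1 + t2).+1, r2, m2; split=> [|//|st]; first by lia.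
apply: ReachS => //=; move/eqP: r0 => ->.
exact: reach_trans (h1 _) (h2 _).
Qed.

Fixpoint straight c : bool :=
  match c with
  | Rand _ _ | While _ _ => false
  | Seq c1 c2 | If _ c1 c2 => straight c1 && straight c2
  | _ => true
  end.

(** Charging both branches of an [If] gives a bound that does not depend on the state. *)
Fixpoint cost c : nat :=
  match c with
  | Seq c1 c2 | If _ c1 c2 => (cost c1 + cost c2).+1
  | _ => 1
  end.

(** A denotational semantics for deterministic loop-free code. The default [s] is the true meaning
    of [Skip] and only a placeholder for [Rand] and [While], which [straight] rules out. *)
Fixpoint den c (s : (nat -> nat) * (nat -> nat)) : (nat -> nat) * (nat -> nat) :=
  let: (r, m) := s in
  match c with
  | Const x a => (upd r x (a %% W), m)
  | Binop op x y z => (upd r x (eval_binop W op (r y) (r z)), m)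
  | Read x y => (upd r x (m (r y)), m)
  | Write x y => (r, upd m (r x) (r y))
  | Query x ys => (upd r x (Q [seq r y | y <- ys]), m)
  | Seq c1 c2 => den c2 (den c1 s)
  | If x c1 c2 => if r x != 0 then den c1 s else den c2 s
  | _ => s
  end.

Lemma runs_straight c r m : straight c ->
  runs c r m (cost c) (fun r' m' => (r', m') = den c (r, m)).
Proof.
have one c0 r0 m0 r' m' :
    (forall st, reach 1 (Config (c0 :: st) r0 m0) (Config st r' m')) ->
    den c0 (r0, m0) = (r', m') -> cost c0 = 1 ->
    runs c0 r0 m0 (cost c0) (fun r' m' => (r', m') = den c0 (r0, m0)).
  by move=> h -> ->; exists 1, r', m'; split.
have R1 (s s' : config k) : ~~ halted s -> branching s = 1 ->
    step W Q s 0 = s' -> reach 1 s s'.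
  by move=> h1 h2 <-; apply: ReachS => //; apply: Reach0.
elim: c r m => [|x a|op x y z|x y|x y|x y|x ys|c1 IH1 c2 IH2|x c1 IH1 c2 IH2|x c IH] r m //.
- by move=> _; apply: one => // st; apply: R1.
- by move=> _; apply: one => // st; apply: R1.
- by move=> _; apply: one => // st; apply: R1.
- by move=> _; apply: one => // st; apply: R1.
- by move=> _; apply: one => // st; apply: R1.
- by move=> _; apply: one => // st; apply: R1.
- move=> /= /andP[s1 s2]; apply: runs_seq (IH1 r m s1) _ => r' m' <-.
  exact: IH2.
- move=> /= /andP[s1 s2]; apply: runs_if.
  case: ifP => _; [apply: runs_le (IH1 _ _ s1)|apply: runs_le (IH2 _ _ s2)]; lia.
Qed.

Lemma runs_den c r m Phi : straight c ->
  Phi (den c (r, m)).1 (den c (r, m)).2 -> runs c r m (cost c) Phi.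
Proof.
by move=> sc ph; apply: runs_post (runs_straight r m sc) => r' m' e; rewrite -e in ph.
Qed.

Definition block (cs : seq (cmd k)) : cmd k := foldr (@Seq k) Skip cs.

Lemma straight_block cs : straight (block cs) = all straight cs.
Proof. by elim: cs => //= c cs ->. Qed.

Lemma den_block_cons c cs s : den (block (c :: cs)) s = den (block cs) (den c s).
Proof. by case: s. Qed.

Lemma den_block_cat cs ds s :
  den (block (cs ++ ds)) s = den (block ds) (den (block cs) s).
Proof.
elim: cs s => [[r m] //|c cs IH s].
by rewrite cat_cons !den_block_cons IH.
Qed.

End Execution.

Arguments straight {k} c.
Arguments cost {k} c.
Arguments block {k} cs.

(** * Certificates *)

Definition meets_halves k (S : {set 'I_(2 * k)}) : bool :=
  [exists i in S, i < k] && [exists i in S, k <= i].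

Definition core_pos k : seq (seq nat) :=
  [seq [seq val i | i <- enum (A : {set 'I_(2 * k)})] |
     A <- enum [set A : {set 'I_(2 * k)} | (#|A| == k) && meets_halves A]].

(* Asking that [0 :: upper half minus one] be an edge ties the colour of the
   upper half to that of vertex 0. *)
Definition anchor_req k (x : nat -> nat) : seq (seq nat) :=
  rcons [seq map x p | p <- core_pos k] (0 :: map x (iota k k.-1)).

(** The bit [b] stands for [v] and 0 having different colours. The lower half has the colour of 0,
    so an edge of [v] with that half witnesses [b = true]. *)
Definition vertex_req k (v : nat) (x : nat -> nat) (b : bool) : seq nat :=
  v :: map x (iota (if b then 0 else k) k.-1).

Definition certifies k (Q : seq nat -> bool) v (x : nat -> nat) b : bool :=
  all Q (anchor_req k x) && Q (vertex_req k v x b).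

Definition certified k Q v x : bool := certifies k Q v x false || certifies k Q v x true.

(** Vertices appear as natural numbers because the program stores them in words; the default [false]
    is arbitrary. *)
Definition color_at n (c : {ffun 'I_n -> bool}) (v : nat) : bool :=
  if insub v is Some i then c i else false.

Lemma color_at_ord n (c : {ffun 'I_n -> bool}) (i : 'I_n) : color_at c i = c i.
Proof. by rewrite /color_at valK. Qed.

Lemma edge_query_not_mono n (H : {set {set 'I_n}}) c s b :
  proper H c -> edge_query H s -> {in s, forall v, color_at c v = b} -> False.
Proof.
move=> /forall_inP hp /andP[_ /hp hm] hs; case/negP: hm.
apply/existsP; exists b; apply/forall_inP => i; rewrite inE => /hs.
by rewrite color_at_ord => ->.
Qed.

(** Supplies the [k]-subset through one position of each half that [core_colors] needs. *)
Lemma ex_subset_card (T : finType) (A : {set T}) i j m :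
  i \in A -> j \in A -> i != j -> m.+2 <= #|A| ->
  exists S : {set T}, [/\ S \subset A, i \in S, j \in S & #|S| = m.+2].
Proof.
move=> iA jA ij le; set B := A :\: [set i; j].
have cB : #|B| = #|A| - 2.
  by rewrite cardsD (setIidPr _) ?cards2 ?ij // subUset !sub1set iA jA.
have us : uniq (take m (enum B)) by rewrite take_uniq ?enum_uniq.
have sub : {subset take m (enum B) <= B}.
  by move=> x /mem_take; rewrite mem_enum.
exists ([set i; j] :|: [set x in take m (enum B)]); split.
- rewrite !subUset !sub1set iA jA /=; apply/subsetP => x.
  by rewrite inE => /sub; rewrite inE => /andP[].
- by rewrite !inE eqxx.
- by rewrite !inE eqxx orbT.
- rewrite cardsU cards2 ij (_ : _ :&: _ = set0) ?cards0 ?subn0.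
    rewrite cardsE (card_uniqP us) size_takel -?cardE; lia.
  apply/setP => x; rewrite !inE; apply/negP => /andP[xij /sub].
  by rewrite !inE xij.
Qed.

Lemma card_lower_half k : #|[set i : 'I_(2 * k) | i < k]| = k.
Proof.
have le : k <= 2 * k by lia.
have inj : injective (widen_ord le) by move=> i j /(congr1 val)/= /val_inj.
rewrite -[RHS]card_ord -(card_imset _ inj).
apply: eq_card => i; rewrite inE; apply/idP/imsetP => [ik|[j _ ->]]; last exact: ltn_ord j.
by exists (Ordinal ik) => //; apply: val_inj.
Qed.

Lemma card_upper_half k : #|[set i : 'I_(2 * k) | k <= i]| = k.
Proof.
rewrite (_ : [set _ | _] = ~: [set i : 'I_(2 * k) | i < k]).
  by have := cardsC [set i : 'I_(2 * k) | i < k]; rewrite card_lower_half card_ord; lia.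
by apply/setP => i; rewrite !inE leqNgt.
Qed.

(* The larger colour class has at least k of the 2k positions, so it cannot
   meet both halves and hence fills one of them. *)
Lemma core_colors k (g : nat -> bool) : 2 <= k ->
  (forall S : {set 'I_(2 * k)}, #|S| = k -> meets_halves S ->
     forall b, ~ {in S, forall i, g (val i) = b}) ->
  exists b, (forall i, i < k -> g i = b) /\
            (forall i, k <= i -> i < 2 * k -> g i = ~~ b).
Proof.
move=> k2 hS; pose P b := [set i : 'I_(2 * k) | g i == b].
have PC b : ~: P b = P (~~ b) by apply/setP => i; rewrite !inE; case: (g i); case: b.
have [b hb] : exists b, k <= #|P b|.
  have := cardsC (P true); rewrite PC card_ord => h.
  by have [?|?] := leqP k #|P true|; [exists true|exists (~~ true); lia].
have nmeet : ~~ meets_halves (P b).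
  apply/negP => /andP[/exists_inP[i iP ik] /exists_inP[j jP jk]].
  have ij : i != j by apply: contraTneq ik => ->; rewrite -leqNgt.
  have [|S [sS iS jS cS]] := ex_subset_card (m := k - 2) iP jP ij; first by rewrite -addn2 subnK.
  apply: (hS S _ _ b); first by rewrite cS -addn2 subnK.
    by apply/andP; split; apply/exists_inP; [exists i|exists j].
  by move=> u /(subsetP sS); rewrite inE => /eqP.
have eqbN a d : (a == ~~ d) = ~~ (a == d) by case: a; case: d.
have mem i (hi : i < 2 * k) : (Ordinal hi \in P b) = (g i == b) by rewrite inE.
have [/exists_inP hl|/exists_inP hl] := boolP [exists i in P b, i < k].
  have E : P b = [set i : 'I_(2 * k) | i < k].
    apply/eqP; rewrite eqEcard card_lower_half hb andbT.
    apply/subsetP => i iP; rewrite inE ltnNge; apply: contra nmeet => ki.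
    by apply/andP; split; apply/exists_inP => //; exists i.
  exists b; split=> i ik => [|i2k].
    have hi : i < 2 * k by lia.
    by apply/eqP; rewrite -(mem _ hi) E inE.
  by apply/eqP; rewrite eqbN -(mem _ i2k) E inE /= -leqNgt.
have E : P b = [set i : 'I_(2 * k) | k <= i].
  apply/eqP; rewrite eqEcard card_upper_half hb andbT.
  apply/subsetP => i iP; rewrite inE leqNgt; apply/negP => ik.
  by apply: hl; exists i.
exists (~~ b); split=> i ik => [|i2k].
  have hi : i < 2 * k by lia.
  by apply/eqP; rewrite eqbN -(mem _ hi) E inE /= -ltnNge.
by rewrite negbK; apply/eqP; rewrite -(mem _ i2k) E inE.
Qed.

(** Each wrong colour would make a required edge monochromatic. The core edges give the halves
    opposite colours [b0] and [~~ b0], the anchor edge then gives 0 the colour [b0], and the edge of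
    [v] gives it [b (+) b0]. *)
Lemma certifies_color k n (H : {set {set 'I_n}}) c v x b : 2 <= k ->
  proper H c -> certifies k (edge_query H) v x b ->
  (color_at c v != color_at c 0) = b.
Proof.
move=> k2 pc /andP[]; rewrite /anchor_req all_rcons => /andP[q0 qc] qv.
have nm s b0 : edge_query H s -> {in s, forall v, color_at c v = b0} -> False.
  exact: edge_query_not_mono.
have [||b0 [lo hi]] := core_colors (k := k) (g := fun i => color_at c (x i)) => //.
  move=> A cA mA b0 h; apply: (nm [seq x (val i) | i <- enum A] b0).
    move/allP: qc; apply; rewrite map_comp; apply: map_f; apply: map_f.
    by rewrite mem_enum inE cA eqxx.
  by move=> _ /mapP[i iA ->]; apply: h; rewrite mem_enum in iA.
have c0 : color_at c 0 = b0.
  apply/eqP; apply: contraT => c0; exfalso; apply: (nm _ (~~ b0) q0) => u.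
  rewrite inE => /predU1P[->|/mapP[i]]; first by case: (color_at c 0) c0; case: (b0).
  by rewrite mem_iota => hi2 ->; apply: hi; lia.
have cv : color_at c v = b (+) b0.
  apply/eqP; apply: contraT => cv; exfalso.
  apply: (nm _ (~~ b (+) b0) qv) => u.
  rewrite inE => /predU1P[->|/mapP[i]].
    by case: (color_at c v) cv; case: (b); case: (b0).
  rewrite mem_iota; case: (b) => hi2 ->; rewrite /=.
    by apply: lo; lia.
  by rewrite hi; [case: (b0)|lia|lia].
by rewrite cv c0; case: (b); case: (b0).
Qed.

(* The first n/(4k) tuples are disjoint blocks; the base-n digits of the index
   then enumerate all tuples. *)
Definition tup k n j i : nat :=
  if j < n %/ (4 * k) then (2 * k * j).+1 + i
  else (j - n %/ (4 * k)) %/ n ^ i %% n.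

Definition tries k n : nat := n %/ (4 * k) + n ^ (2 * k).

Definition fails k n Q v j : bool :=
  all (fun i => ~~ certified k Q v (tup k n i)) (iota 0 j).

Lemma failsS k n Q v j :
  fails k n Q v j.+1 = fails k n Q v j && ~~ certified k Q v (tup k n j).
Proof. by rewrite /fails -addn1 iotaD all_cat /= andbT. Qed.

(** Tuple [j] is examined exactly if all earlier tuples fail, so this sum counts the tuples examined
    for [v]. *)
Definition num_tries k n Q v : nat := \sum_(j < tries k n) fails k n Q v j.

Definition stuck k n Q : bool :=
  has (fun v => fails k n Q v (tries k n)) (iota 0 n).

(** * The program *)

Section Program.
Variable k : nat.

Definition regs (s : seq nat) : k.-tuple nat := [tuple nth 0 s i | i < k].

Lemma regsE s : size s = k -> tval (regs s) = s.
Proof.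
move=> sz; apply: (@eq_from_nth _ 0); rewrite size_tuple // => i ik.
by rewrite -[i]/(val (Ordinal ik)) -tnth_nth tnth_mktuple.
Qed.

(* Registers: 0 holds n, 1 the constant 1, 2 the current vertex, 3 the index of
   the current tuple, 4 and 5 the numbers of blocks and of tuples, 6 and 7 loop
   tests, 10 the conjunction of the answers, 11 the colour found, 12 a success
   flag, 13 the constant 0, 14 the constant 2k, 15 the last answer, 16 n^k,
   20 + i the i-th vertex of the tuple, and 8 and 9 are scratch. *)

Definition put_digits (l : seq nat) : seq (cmd k) :=
  flatten [seq [:: Binop Mod (20 + i) 8 0; Binop Div 8 8 0] | i <- l].

Definition put_successive (l : seq nat) : seq (cmd k) :=
  flatten [seq [:: Binop Add (20 + i) 8 13; Binop Add 8 8 1] | i <- l].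

Definition decode : seq (cmd k) :=
  [:: Binop Ltb 9 3 4;
      If 9 (block ([:: Binop Mul 8 3 14; Binop Add 8 8 1] ++
                   put_successive (iota 0 (2 * k))))
           (block (Binop Sub 8 3 4 :: put_digits (iota 0 (2 * k))))].

Definition query_all (l : seq (seq nat)) : seq (cmd k) :=
  flatten [seq [:: Query 15 (regs s); Binop Mul 10 10 15] | s <- l].

Definition anchor_regs : seq (seq nat) :=
  rcons [seq map (addn 20) p | p <- core_pos k] (13 :: map (addn 20) (iota k k.-1)).

Definition vertex_regs (b : bool) : seq nat :=
  2 :: map (addn 20) (iota (if b then 0 else k) k.-1).

Definition try_color (b : bool) : seq (cmd k) :=
  [:: Query 15 (regs (vertex_regs b)); Binop Mul 15 15 10;
      If 15 (block [:: Const 12 1; Const 11 (b : nat)]) Skip].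

(** The new loop test in register 7 is the product of two flags: tuples are left, and no certificate
    has been found. *)
Definition inner_body : cmd k :=
  block (decode ++ Const 10 1 :: query_all anchor_regs ++
         try_color false ++ try_color true ++
         [:: Binop Add 3 3 1; Binop Ltb 7 3 5; Binop Sub 9 1 12; Binop Mul 7 7 9]).

Definition outer_body : cmd k :=
  Seq (block [:: Const 3 0; Const 12 0; Const 7 1])
  (Seq (While 7 inner_body)
       (If 12 (block [:: Write 2 11; Binop Add 2 2 1; Binop Ltb 6 2 0]) (Const 6 0))).

Definition prologue : cmd k :=
  block ([:: Const 1 1; Const 8 (4 * k); Binop Div 4 0 8; Const 14 (2 * k);
             Const 5 1; Const 16 1] ++
         nseq (2 * k) (Binop Mul 5 5 0) ++ nseq k (Binop Mul 16 16 0) ++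
         [:: Binop Add 5 5 4; Binop Ltb 6 13 0]).

(** The certificate phase may have coloured some vertices before getting stuck, while the exhaustive
    search has to start from the all-zero colouring. *)
Definition reset : cmd k :=
  Seq (block [:: Const 2 0; Binop Ltb 6 2 0])
      (While 6 (block [:: Write 2 13; Binop Add 2 2 1; Binop Ltb 6 2 0])).

Definition mono_factors (l : seq nat) : seq (cmd k) :=
  flatten [seq [:: Read 11 (20 + i); Binop Eqb 11 11 9; Binop Mul 15 15 11] | i <- l].

Definition verify_body : cmd k :=
  block (Binop Add 8 3 13 :: put_digits (iota 0 k) ++
         [:: Query 15 (regs (map (addn 20) (iota 0 k))); Read 9 20] ++
         mono_factors (iota 0 k) ++
         [:: If 15 (Const 12 1) Skip; Binop Add 3 3 1; Binop Ltb 7 3 16]).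

(** The first [n] memory cells serve as a binary counter with the lowest bit in cell 0: trailing
    ones are cleared and the next bit is set. *)
Definition increment : cmd k :=
  Seq (block [:: Const 2 0; Read 7 2])
  (Seq (While 7 (block [:: Write 2 13; Binop Add 2 2 1; Read 7 2])) (Write 2 1)).

(** In this phase register 12 flags a monochromatic edge of the current colouring: it triggers
    [increment], and otherwise the search stops. *)
Definition search_body : cmd k :=
  Seq (block [:: Const 3 0; Const 12 0; Binop Ltb 7 13 16])
  (Seq (While 7 verify_body) (If 12 increment (Const 6 0))).

Definition exhaustive : cmd k :=
  Seq reset (Seq (Const 6 1) (While 6 search_body)).

Definition program : cmd k :=
  Seq prologue (Seq (While 6 outer_body)
    (Seq (Binop Ltb 6 2 0) (If 6 exhaustive Skip))).

(** The exponent [4 * k] leaves room for the number of tuples, about [n ^ (2 * k)], and for the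
    constants of the program; see [word_boundE]. *)
Definition coloring_algorithm : algorithm k := Algorithm program (4 * k).

End Program.

Lemma upd_notin f x a y (L : seq nat) : y \in L -> x \notin L -> upd f x a y = f y.
Proof. by move=> yL xL; rewrite /upd; case: eqP => // e; rewrite -e yL in xL. Qed.

Ltac upd_tac := rewrite /upd; repeat (case: eqP; try lia).

(** * Effect of the loop-free program fragments *)

Section Straight.
Variables (k W : nat) (Q : seq nat -> bool).
Implicit Types (r m : nat -> nat).

Lemma den_put_digits n a len r m : r 0 = n ->
  exists r', [/\ den W Q (block (put_digits k (iota a len))) (r, m) = (r', m),
    forall i, i < len -> r' (20 + (a + i)) = r 8 %/ n ^ i %% n &
    forall y, y <> 8 -> (y < 20 + a) || (20 + (a + len) <= y) -> r' y = r y].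
Proof.
elim: len a r => [|len IH] a r r0; first by exists r.
rewrite [put_digits _ _]/= !den_block_cons.
rewrite {2}/den {2}/den /eval_binop.
set r1 := upd _ 8 _.
have r10 : r1 0 = n by rewrite /r1; upd_tac.
have r18 : r1 8 = r 8 %/ n.
  by rewrite /r1 /upd eqxx -r0; congr (_ %/ _); case: eqP; lia.
have r1a : r1 (20 + a) = r 8 %% n.
  by rewrite /r1 -r0; upd_tac.
have r1y y : y <> 8 -> y <> 20 + a -> r1 y = r y by move=> ? ?; rewrite /r1; upd_tac.
have [r' [e h1 h2]] := IH a.+1 r1 r10.
exists r'; split=> [//|[|i] il|y y8 hy].
- by rewrite h2 ?addn0 ?r1a ?expn0 ?divn1 //; lia.
- by rewrite addnS -addSn h1 // r18 expnS divnMA.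
- by rewrite h2 ?r1y //; lia.
Qed.

Lemma den_put_successive a len r m : r 13 = 0 -> r 1 = 1 -> r 8 + len < W ->
  exists r', [/\ den W Q (block (put_successive k (iota a len))) (r, m) = (r', m),
    forall i, i < len -> r' (20 + (a + i)) = r 8 + i &
    forall y, y <> 8 -> (y < 20 + a) || (20 + (a + len) <= y) -> r' y = r y].
Proof.
elim: len a r => [|len IH] a r r13 r1 hW; first by exists r.
rewrite [put_successive _ _]/= !den_block_cons.
rewrite {2}/den {2}/den /eval_binop.
set r2 := upd _ 8 _.
have r28 : r2 8 = (r 8).+1.
  rewrite /r2 /upd eqxx; do 2 (case: eqP; first by lia); move=> _ _.
  by rewrite r1 addn1 modn_small //; lia.
have r2a : r2 (20 + a) = r 8.
  by rewrite /r2 r13 addn0 modn_small; [upd_tac|lia].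
have r2y y : y <> 8 -> y <> 20 + a -> r2 y = r y by move=> ? ?; rewrite /r2; upd_tac.
have r213 : r2 13 = 0 by rewrite r2y //; lia.
have r21 : r2 1 = 1 by rewrite r2y //; lia.
have [|r' [e h1 h2]] := IH a.+1 r2 r213 r21; first by rewrite r28; lia.
exists r'; split=> [//|[|i] il|y y8 hy].
- by rewrite h2 ?addn0 ?r2a //; lia.
- by rewrite addnS -addSn h1 // r28; lia.
- by rewrite h2 ?r2y //; lia.
Qed.

Lemma den_decode n j r m : r 0 = n -> r 1 = 1 -> r 13 = 0 -> r 14 = 2 * k ->
  r 4 = n %/ (4 * k) -> r 3 = j -> n + 2 * k + 1 < W -> 0 < k ->
  exists r', [/\ den W Q (block (decode k)) (r, m) = (r', m),
    forall i, i < 2 * k -> r' (20 + i) = tup k n j i &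
    forall y, y < 20 -> y <> 8 -> y <> 9 -> r' y = r y].
Proof.
move=> r0 r1 r13 r14 r4 r3 hW k0.
rewrite /decode den_block_cons [X in den _ _ _ X]/= r3 r4.
set r2 := upd r 9 _.
have r29 : r2 9 = (j < n %/ (4 * k)) by [].
have r2y y : y <> 9 -> r2 y = r y by move=> ?; rewrite /r2; upd_tac.
have -> c1 c2 s : den W Q (block [:: If 9 c1 c2]) (r2, s) =
    if r2 9 != 0 then den W Q c1 (r2, s) else den W Q c2 (r2, s).
  by rewrite /= ; case: ifP => _; case: den.
rewrite r29 /tup; case: ltnP => hj /=.
  have hjn : (2 * k * j).+1 + 2 * k <= n.+1.
    have : j.+1 * (4 * k) <= n by rewrite -leq_divRL //; lia.
    nia.
  set r6 := upd _ 8 _.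
  have r68 : r6 8 = (2 * k * j).+1.
    by rewrite /r6 /upd /= !r2y // r3 r14 r1 modn_small ?modn_small ?addn1 1?mulnC //; nia.
  have r6y y : y <> 8 -> r6 y = r2 y by move=> ?; rewrite /r6; upd_tac.
  have [|||r' [e h1 h2]] := @den_put_successive 0 (2 * k) r6 m.
  - by rewrite r6y // r2y.
  - by rewrite r6y // r2y.
  - by rewrite r68; lia.
  exists r'; split=> [//|i hi|y y20 y8 y9]; first by rewrite (h1 i hi) r68.
  by rewrite h2 ?r6y ?r2y //; lia.
rewrite -/(block _) !r2y // r3 r4.
set r5 := upd _ 8 _.
have r5y y : y <> 8 -> r5 y = r2 y by move=> ?; rewrite /r5; upd_tac.
have [|r' [e h1 h2]] := @den_put_digits n 0 (2 * k) r5 m; first by rewrite r5y ?r2y.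
exists r'; split=> [//|i hi|y y20 y8 y9].
  by rewrite (h1 i hi).
by rewrite h2 ?r5y ?r2y //; lia.
Qed.

Lemma den_query_all l r m (b : bool) : r 10 = b -> 1 < W ->
  {in l, forall s, size s = k /\ {in s, forall y, y <> 10 /\ y <> 15}} ->
  exists r', [/\ den W Q (block (query_all k l)) (r, m) = (r', m),
    r' 10 = b && all (fun s => Q (map r s)) l &
    forall y, y <> 10 -> y <> 15 -> r' y = r y].
Proof.
move=> + W1; elim: l r b => [|s l IH] r b r10 hl.
  by exists r; rewrite andbT.
rewrite [query_all _ _]/= !den_block_cons [X in den _ _ _ X]/=.
set r1 := upd (upd _ _ _) _ _.
have [hs hy] := hl s (mem_head _ _).
have r110 : r1 10 = b && Q (map r s).
  rewrite /r1 /upd /= r10 regsE //; rewrite modn_small.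
    by case: (b); case: (Q _).
  by case: (b); case: (Q _) => /=; lia.
have r1y y : y <> 10 -> y <> 15 -> r1 y = r y by move=> ? ?; rewrite /r1; upd_tac.
have [|r' [e h1 h2]] := IH r1 _ r110.
  by move=> s' s'l; apply: hl; rewrite inE s'l orbT.
exists r'; split=> [//||y y10 y15].
  rewrite h1 /= andbA; congr (_ && _ : bool).
  apply: eq_in_all => s' s'l; congr Q; apply/eq_in_map => y ys.
  have [|_ /(_ y ys)[y10 y15]] := hl s'; first by rewrite inE s'l orbT.
  exact: r1y.
by rewrite h2 // r1y.
Qed.

Lemma den_try_color b r m (F f : bool) : r 10 = F -> r 12 = f -> 1 < W -> 0 < k ->
  exists r', [/\ den W Q (block (try_color k b)) (r, m) = (r', m),
    r' 12 = f || F && Q (map r (vertex_regs k b)),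
    r' 11 = (if F && Q (map r (vertex_regs k b)) then b : nat else r 11) &
    forall y, y <> 11 -> y <> 12 -> y <> 15 -> r' y = r y].
Proof.
move=> r10 r12 W1 k0; rewrite /try_color !den_block_cons [X in den _ _ (If _ _ _) X]/=.
rewrite regsE; last by rewrite /vertex_regs /= size_map size_iota; lia.
set q := Q _; set r1 := upd (upd _ _ _) _ _.
have r115 : r1 15 = F && q.
  rewrite /r1 /upd /= r10 modn_small; first by case: (F); case: (q).
  by case: (F); case: (q) => /=; lia.
have r1y y : y <> 15 -> r1 y = r y by move=> ?; rewrite /r1; upd_tac.
rewrite /= r115; case: (F && q) => /=.
  rewrite !modn_small //; last by case: (b); lia.
  eexists; split; first by reflexivity.
  - by rewrite /upd /= orbT.
  - by [].
  - by move=> y ? ? ?; rewrite -(r1y y) //; upd_tac.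
by exists r1; rewrite orbF !r1y //; split=> // y ? ? ?; apply: r1y.
Qed.

Lemma core_pos_bound p : p \in core_pos k ->
  size p = k /\ {in p, forall i, i < 2 * k}.
Proof.
move=> /mapP[A]; rewrite mem_enum inE => /andP[/eqP cA _] ->; split.
  by rewrite size_map -cardE.
by move=> _ /mapP[i _ ->]; exact: ltn_ord.
Qed.

Lemma den_inner_body n v j r m : let x := tup k n j in
  r 0 = n -> r 1 = 1 -> r 2 = v -> r 3 = j -> r 4 = n %/ (4 * k) ->
  r 5 = tries k n -> r 12 = 0 -> r 13 = 0 -> r 14 = 2 * k ->
  n + 2 * k + 1 < W -> j.+1 < W -> 0 < k ->
  exists r', [/\ den W Q (inner_body k) (r, m) = (r', m),
    r' 3 = j.+1, r' 12 = certified k Q v x,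
    r' 7 = (j.+1 < tries k n) && ~~ certified k Q v x &
    (r' 12 <> 0 -> r' 11 = certifies k Q v x true) /\
    forall y, y \in [:: 0; 1; 2; 4; 5; 6; 13; 14; 16] -> r' y = r y].
Proof.
move=> x r0 r1 r2 r3 r4 r5 r12 r13 r14 hW hj k0.
have [ra [ea xa fa]] := den_decode m r0 r1 r13 r14 r4 r3 hW k0.
rewrite /inner_body den_block_cat ea den_block_cons [X in den _ _ _ X]/=.
set rb := upd _ 10 _.
have rb10 : rb 10 = true by rewrite /rb /upd eqxx modn_small //; lia.
have rby y : y <> 10 -> rb y = ra y by move=> ?; rewrite /rb; upd_tac.
have W1 : 1 < W by lia.
have [|rc [ec c10 fc]] := den_query_all (l := anchor_regs k) m rb10 W1.
  move=> s; rewrite mem_rcons inE => /predU1P[->|/mapP[p pc ->]].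
    rewrite /= size_map size_iota; split; first by lia.
    by move=> y; rewrite inE => /predU1P[->|/mapP[i _ ->]]; lia.
  have [sp bp] := core_pos_bound pc; rewrite size_map; split=> //.
  by move=> _ /mapP[i _ ->]; lia.
rewrite den_block_cat ec.
have rc10 : rc 10 = all Q (anchor_req k x).
  move: core_pos_bound; rewrite c10 /anchor_regs /anchor_req.
  move: (core_pos k) => ps bnd; rewrite !all_rcons !all_map /=.
  rewrite rby // fa // r13 -map_comp.
  congr (Q _ && _ : bool).
    congr cons; apply/eq_in_map => i; rewrite mem_iota => hi /=.
    by rewrite rby ?xa //; lia.
  apply: eq_in_all => p pc /=; have [_ hp] := bnd p pc; congr Q.
  rewrite -map_comp; apply/eq_in_map => i /hp hi /=.
  by rewrite rby ?xa //; lia.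
have vq r' b : r' 2 = v -> (forall i, i < 2 * k -> r' (20 + i) = x i) ->
    map r' (vertex_regs k b) = vertex_req k v x b.
  move=> h2 hx; rewrite /vertex_regs /vertex_req /= h2 -map_comp; congr cons.
  by apply/eq_in_map => i; rewrite mem_iota => hi /=; rewrite hx //; case: (b) hi; lia.
have rc12 : rc 12 = false by rewrite fc // rby // fa.
have [rd [ed d12 d11 fd]] := den_try_color false m rc10 rc12 W1 k0.
rewrite den_block_cat ed.
have rd10 : rd 10 = all Q (anchor_req k x) by rewrite fd.
have [re [ee e12 e11 fe]] := den_try_color true m rd10 d12 W1 k0.
rewrite den_block_cat ee.
rewrite vq in d12 d11 e12; last 2 first.
- by rewrite fc // rby // fa.
- by move=> i hi; rewrite fc ?rby ?xa //; lia.
rewrite vq in e12 e11; last 2 first.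
- by rewrite fd // fc // rby // fa.
- by move=> i hi; rewrite fd ?fc ?rby ?xa //; lia.
have fr y : y < 20 -> y \notin [:: 8; 9; 10; 11; 12; 15] -> re y = r y.
  by rewrite !inE => h1 h2; rewrite fe ?fd ?fc ?rby ?fa //; lia.
have E12 : re 12 = certified k Q v x by rewrite e12 /certified /certifies.
eexists; split; first by reflexivity.
- by rewrite /upd /= !fr // r3 r1 addn1 modn_small.
- by rewrite /upd /=.
- rewrite /upd /= E12 !fr // r3 r1 r5 addn1 (modn_small hj).
  by case: (j.+1 < _); case: (certified _ _ _ _); rewrite /= modn_small // ltnW.
split.
  rewrite /upd /= E12 e11 d11 /certified /certifies.
  by case: (all Q _); case: (Q _); case: (Q _).
move=> y hy; rewrite !(upd_notin _ _ hy) //.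
have /andP[y20 y8] := allP (isT : all (fun y => (y < 20) &&
  (y \notin [:: 8; 9; 10; 11; 12; 15])) [:: 0; 1; 2; 4; 5; 6; 13; 14; 16]) y hy.
exact: fr.
Qed.

End Straight.

(** * The search for certificates *)

Section Loops.
Variables (k n W : nat) (Q : seq nat -> bool).
Hypotheses (k0 : 0 < k) (hW : tries k n + n + 4 * k + 2 < W).
Implicit Types (r m : nat -> nat).

Lemma straight_flatten (T : Type) (f : T -> seq (cmd k)) l :
  (forall i, all straight (f i)) -> all straight (flatten (map f l)).
Proof. by move=> h; elim: l => //= i l IH; rewrite all_cat h IH. Qed.

Lemma straight_inner_body : straight (inner_body k).
Proof.
rewrite /inner_body straight_block !all_cat /= !all_cat !straight_block /=.
by rewrite !straight_flatten.
Qed.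

Definition frame (L : seq nat) r r' := forall y, y \in L -> r' y = r y.

Definition kept := [:: 0; 1; 2; 4; 5; 6; 13; 14; 16].

Definition ready r := [/\ r 0 = n, r 1 = 1, r 4 = n %/ (4 * k) &
  [/\ r 5 = tries k n, r 13 = 0, r 14 = 2 * k & r 16 = n ^ k]].

Lemma runs_inner v r m : ready r -> r 2 = v -> r 3 = 0 -> r 7 = 1 -> r 12 = 0 ->
  0 < tries k n ->
  runs W Q (While 7 (inner_body k)) r m
    ((cost (inner_body k)).+1 * num_tries k n Q v).+1
    (fun r' m' => [/\ m' = m, r' 12 = ~~ fails k n Q v (tries k n),
       r' 12 <> 0 -> exists2 x, certifies k Q v x (r' 11 != 0) & r' 11 <= 1 &
       frame kept r r']).
Proof.
move=> [r0 r1 r4 [r5 r13 r14 r16]] r2 r3 r7 r12 t0.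
set K := cost _.
(* The tail [rest j] of the sum [num_tries] counts the tuples still to be examined. The first
   alternative of the invariant is the running search, the second the state after success, where
   only the final loop test remains. *)
pose rest j := \sum_(j <= l < tries k n) fails k n Q v l.
pose I B r' m' := m' = m /\ frame kept r r' /\
  ((exists j, [/\ j <= tries k n, fails k n Q v j, r' 3 = j,
      r' 12 = 0 & r' 7 = (j < tries k n) /\ B = (K.+1 * rest j).+1]) \/
   [/\ r' 7 = 0, r' 12 = 1, ~~ fails k n Q v (tries k n), 0 < B &
       exists2 x, certifies k Q v x (r' 11 != 0) & r' 11 <= 1]).
apply: (@runs_while _ _ _ 7 _ I).
- move=> B r' m' [-> [fr [[j [jt fj e3 e12 [e7 ->]]]|[e7 e12 nf B0 hx]]]] z7; split=> //.
    move: z7; rewrite e7; case: ltnP => // jt' _.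
    have ej : j = tries k n by lia.
    by split=> //; rewrite e12 // -ej fj.
  by split=> //; rewrite e12 nf.
- move=> B r' m' [-> [fr [[j [jt fj e3 e12 [e7 ->]]]|[e7 e12 nf B0 hx]]]] nz7; last by [].
  have jt' : j < tries k n by move: nz7; rewrite e7; case: ltnP.
  have [e0 e1 e4 [e5 e13 e14 e16]] : ready r' by rewrite /ready !fr.
  have e2 : r' 2 = v by rewrite fr.
  have w1 : n + 2 * k + 1 < W by lia.
  have w2 : j.+1 < W by lia.
  have [ra [ea a3 a12 a7 [a11 fa]]] :=
    den_inner_body Q m e0 e1 e2 e3 e4 e5 e12 e13 e14 w1 w2 k0.
  exists K; exists ((K.+1 * rest j.+1).+1); split.
    by rewrite /rest [in X in _ < X]big_ltn // fj; nia.
  apply: runs_den; first exact: straight_inner_body.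
  rewrite ea /=; split=> //; split; first by move=> y hy; rewrite fa // fr.
  move: (failsS k n Q v j) a12 a7 a11; rewrite fj /=.
  have [cj|ncj] := boolP (certified _ _ _ _) => fS a12 a7 a11.
    right; split=> //; first by rewrite a7 andbF.
      apply: contraFN fS => /allP h; apply/allP => i; rewrite mem_iota => hi.
      by apply: h; rewrite mem_iota; lia.
    exists (tup k n j); last by rewrite a11 ?a12; [case: certifies|].
    rewrite a11 ?a12 //; move: cj; rewrite /certified.
    by case: (boolP (certifies _ _ _ _ true)) => //; rewrite orbF.
  by left; exists j.+1; split=> //; rewrite a7 andbT.
- split=> //; split=> //; left; exists 0; split=> //; rewrite r7 t0; split=> //.
  by rewrite /rest big_mkord.
Qed.

Definition colors_upto v m :=
  forall u, u < v -> m u <= 1 /\ exists x, certifies k Q u x (m u != 0).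

Definition outer_cost := cost (inner_body k) + 30.

Lemma runs_outer r m : ready r -> r 2 = 0 -> r 6 = (0 < n) ->
  runs W Q (While 6 (outer_body k)) r m
    (outer_cost * \sum_(v < n) (num_tries k n Q v).+1).+1
    (fun r' m' => [/\ ready r', r' 2 <= n, colors_upto (r' 2) m' &
       r' 2 < n -> stuck k n Q]).
Proof.
move=> rd0 r2 r6.
(* The first alternative of the invariant covers progress through the vertices, the second the early
   exit at a vertex without a certificate. *)
pose rest j := \sum_(j <= l < n) (num_tries k n Q l).+1.
pose I B r' m' := ready r' /\ colors_upto (r' 2) m' /\
  ((r' 2 <= n /\ r' 6 = (r' 2 < n) /\ B = (outer_cost * rest (r' 2)).+1) \/
   [/\ r' 6 = 0, r' 2 < n, stuck k n Q & 0 < B]).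
apply: (@runs_while _ _ _ 6 _ I).
- move=> B r' m' [rd [cu [[le [e6 ->]]|[e6 lt st B0]]]] z6; split=> //; split=> //.
    by move=> lt; move: z6; rewrite e6 lt.
  exact: ltnW.
- move=> B r' m' [rd [cu [[le [e6 ->]]|[e6 lt st B0]]]] nz6; last by [].
  have lt : r' 2 < n by move: nz6; rewrite e6; case: (r' 2 < n).
  set v := r' 2 in cu lt le e6 *.
  have tn0 : 0 < tries k n by rewrite /tries addn_gt0 expn_gt0; lia.
  exists (7 + ((cost (inner_body k)).+1 * num_tries k n Q v + 13).+1).+1.
  exists (outer_cost * rest v.+1).+1; split.
    rewrite /rest [in X in _ < X]big_ltn // mulnDr /outer_cost.
    by move: (_ * \sum_(_ <= _ < _) _) => a; nia.
  move: rd => [e0 e1 e4 [e5 e13 e14 e16]].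
  apply: (runs_seq (Psi := fun r1 m1 => [/\ m1 = m', frame kept r' r1, r1 3 = 0,
                       r1 7 = 1 & r1 12 = 0])).
    apply: runs_den => //=; split=> //; rewrite /upd /= ?mod0n ?modn_small //; try lia.
    by move=> y; rewrite !inE => hy; upd_tac.
  move=> r1 m1 [-> f1 h3 h7 h12].
  have rd1 : ready r1 by rewrite /ready !f1.
  apply: (@runs_le _ _ _ _ _ _ (((cost (inner_body k)).+1 * num_tries k n Q v).+1 + 12).+1).
    by lia.
  apply: runs_seq (runs_inner m' rd1 (f1 2 _) h3 h7 h12 tn0) _ => //.
  move=> r3 m3 [-> g12 g11 f3]; apply: runs_if.
  have e3 y : y \in kept -> r3 y = r' y by move=> hy; rewrite f3 // f1.
  have rd3 : ready r3 by rewrite /ready !e3.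
  case: eqP => h12'; rewrite /=.
    apply: (@runs_le _ _ _ _ _ _ 1) => //; apply: runs_den => //=.
    split; first by move: rd3 => [? ? ? [? ? ? ?]]; rewrite /ready /upd /=.
    rewrite /upd /= e3 //; split=> //; right; rewrite mod0n; split=> //.
    apply/hasP; exists v; first by rewrite mem_iota; lia.
    by move: g12; rewrite h12'; case: fails.
  have [x cx le1] := g11 h12'.
  apply: (@runs_le _ _ _ _ _ _ 7) => //; apply: runs_den => //=.
  have v1 : (v + 1) %% W = v.+1 by rewrite modn_small; lia.
  split; first by move: rd3 => [? ? ? [? ? ? ?]]; rewrite /ready /upd /=.
  rewrite /upd /= (e3 2) // (e3 1) // (e3 0) // e1 v1 e0; split; last by left.
  move=> u uv; case: eqP => [->|ne]; first by split=> //; exists x.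
  by apply: cu; rewrite /v in ne *; lia.
- split=> //; split; first by rewrite r2.
  by left; rewrite r2 r6 /rest big_mkord.
Qed.
End Loops.

Lemma digits_exist b m (f : nat -> nat) : (forall i, i < m -> f i < b) ->
  exists2 N, N < b ^ m & forall i, i < m -> N %/ b ^ i %% b = f i.
Proof.
elim: m f => [|m IH] f hf; first by exists 0.
have [i hi|N hN eN] := IH (fun i => f i.+1); first exact: hf.
have f0 : f 0 < b by apply: hf.
exists (N * b + f 0); first by rewrite expnS; nia.
case=> [|i] hi; first by rewrite expn0 divn1 modnMDl modn_small.
by rewrite expnS divnMA divnMDl ?(divn_small f0) ?addn0 ?eN //; lia.
Qed.

(** * Exhaustive search over all colourings *)

Section Exhaustive.
Variables (k n W : nat) (Q : seq nat -> bool).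
Hypotheses (k0 : 0 < k) (hW : tries k n + n + 4 * k + 2 < W) (nkW : n ^ k + 1 < W).
Implicit Types (r m : nat -> nat).

Definition kept2 := [:: 0; 1; 2; 6; 13; 16].

Definition ready2 r := [/\ r 0 = n, r 1 = 1, r 13 = 0 & r 16 = n ^ k].

Lemma ready2_frame r r' : ready2 r -> (forall y, y \in [:: 0; 1; 13; 16] -> r' y = r y) ->
  ready2 r'.
Proof. by move=> [? ? ? ?] h; rewrite /ready2 !h. Qed.

Definition digit_seq t := [seq t %/ n ^ i %% n | i <- iota 0 k].

(** Since [t %% n] is the lowest digit of [t], all colours are compared with that of the first
    vertex of the tuple. *)
Definition violated m t :=
  Q (digit_seq t) && all (fun u => m u == m (t %% n)) (digit_seq t).

Lemma den_mono_factors l r m (b : bool) : r 15 = b ->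
  exists r', [/\ den W Q (block (mono_factors k l)) (r, m) = (r', m),
    r' 15 = b && all (fun i => m (r (20 + i)) == r 9) l &
    forall y, y <> 11 -> y <> 15 -> r' y = r y].
Proof.
elim: l r b => [|i l IH] r b r15; first by exists r; rewrite andbT.
rewrite [mono_factors _ _]/= !den_block_cons [X in den _ _ _ X]/=.
set r1 := upd _ 15 _.
have r115 : r1 15 = b && (m (r (20 + i)) == r 9).
  rewrite /r1 /upd /= r15 modn_small; first by case: (b); case: (_ == _).
  by case: (b); case: (_ == _) => /=; lia.
have r1y y : y <> 11 -> y <> 15 -> r1 y = r y by move=> ? ?; rewrite /r1; upd_tac.
have [r' [e h1 h2]] := IH r1 _ r115.
exists r'; split=> [//||y y11 y15]; last by rewrite h2 // r1y.
rewrite h1 /= andbA; congr (_ && _ : bool); exact: eq_all.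
Qed.

Lemma den_verify_body t r m : ready2 r -> r 3 = t -> t < n ^ k ->
  exists r', [/\ den W Q (verify_body k) (r, m) = (r', m),
    r' 3 = t.+1, r' 12 = (if violated m t then 1 else r 12), r' 7 = (t.+1 < n ^ k) &
    forall y, y \in kept2 -> r' y = r y].
Proof.
move=> [r0 r1 r13 r16] r3 tk.
rewrite /verify_body den_block_cons [X in den _ _ _ X]/=.
set ra := upd r 8 _.
have ra8 : ra 8 = t by rewrite /ra /upd eqxx r3 r13 addn0 modn_small //; lia.
have ray y : y <> 8 -> ra y = r y by move=> ?; rewrite /ra; upd_tac.
have [|rb [eb hb fb]] := @den_put_digits k W Q n 0 k ra m; first by rewrite ray.
rewrite den_block_cat eb den_block_cat !den_block_cons [X in den _ _ _ X]/=.
rewrite regsE; last by rewrite size_map size_iota.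
have -> : [seq rb y | y <- [seq 20 + i | i <- iota 0 k]] = digit_seq t.
  rewrite -map_comp; apply/eq_in_map => i; rewrite mem_iota => hi /=.
  by rewrite (hb i) ?ra8 //; lia.
set rc := upd _ 9 _.
have rc15 : rc 15 = Q (digit_seq t) by [].
have rc9 : rc 9 = m (t %% n).
  by rewrite /rc /upd /= -[20]/(20 + (0 + 0)) hb // ra8 expn0 divn1.
have rcy y : y <> 9 -> y <> 15 -> rc y = rb y by move=> ? ?; rewrite /rc; upd_tac.
have [rd [ed d15 fd]] := den_mono_factors (iota 0 k) m rc15.
rewrite den_block_cat ed.
have rd15 : rd 15 = violated m t.
  rewrite d15 rc9 /violated [in RHS]/digit_seq all_map; congr (_ && _ : bool).
  apply: eq_in_all => i; rewrite mem_iota => hi /=.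
  by rewrite rcy ?(hb i) ?ra8 //; lia.
have fr y : y < 20 -> y \notin [:: 8; 9; 11; 15] -> rd y = r y.
  by rewrite !inE => h1 h2; rewrite fd ?rcy ?fb ?ray //; lia.
have frk y : y \in kept2 -> rd y = r y.
  move=> hy; have /andP[y20 y8] := allP (isT : all (fun y => (y < 20) &&
    (y \notin [:: 8; 9; 11; 15])) kept2) y hy.
  exact: fr.
have E : (t + 1) %% W = t.+1 by rewrite modn_small; lia.
rewrite !den_block_cons [den _ _ (If _ _ _) _]/= rd15.
case: (violated m t) => /=; (eexists; split; first by reflexivity).
- by rewrite /upd /= !fr // r3 r1 E.
- by rewrite /upd /= modn_small //; lia.
- by rewrite /upd /= !fr // r3 r1 r16 E.
- by move=> y hy; rewrite !(upd_notin _ _ hy) // frk.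
- by rewrite /upd /= !fr // r3 r1 E.
- by rewrite /upd /= fr.
- by rewrite /upd /= !fr // r3 r1 r16 E.
- by move=> y hy; rewrite !(upd_notin _ _ hy) // frk.
Qed.

Lemma straight_verify_body : straight (verify_body k).
Proof.
rewrite /verify_body straight_block /= !all_cat /= all_cat /=.
by rewrite !straight_flatten.
Qed.

Lemma runs_verify r m : ready2 r -> r 3 = 0 -> r 7 = (0 < n ^ k) -> r 12 = 0 ->
  runs W Q (While 7 (verify_body k)) r m ((cost (verify_body k)).+1 * n ^ k).+1
    (fun r' m' => [/\ m' = m, r' 12 = has (violated m) (iota 0 (n ^ k)) &
       forall y, y \in kept2 -> r' y = r y]).
Proof.
move=> rd r3 r7 r12; set K := cost _.
pose I B r' m' := m' = m /\ (forall y, y \in kept2 -> r' y = r y) /\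
  exists t, [/\ t <= n ^ k, r' 3 = t, r' 7 = (t < n ^ k),
    r' 12 = has (violated m) (iota 0 t) & B = (K.+1 * (n ^ k - t)).+1].
apply: (@runs_while _ _ _ 7 _ I).
- move=> B r' m' [-> [fr [t [le e3 e7 e12 ->]]]] z7; split=> //; split=> //.
  by rewrite e12; congr (has _ (iota 0 _) : nat); move: z7; rewrite e7; case: ltnP => //; lia.
- move=> B r' m' [-> [fr [t [le e3 e7 e12 ->]]]] nz7.
  have lt : t < n ^ k by move: nz7; rewrite e7; case: ltnP.
  have rd' : ready2 r'.
    by apply: ready2_frame rd _ => y hy; apply: fr; move: hy; rewrite !inE; lia.
  have [ra [ea a3 a12 a7 fa]] := den_verify_body m rd' e3 lt.
  exists K, (K.+1 * (n ^ k - t.+1)).+1; split; first by nia.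
  apply: runs_den; first exact: straight_verify_body.
  rewrite ea /=; split=> //; split; first by move=> y hy; rewrite fa // fr.
  exists t.+1; split=> //.
  rewrite a12 e12 -(addn1 t) iotaD has_cat /= orbF.
  by case: violated; rewrite ?orbT ?orbF.
- by split=> //; split=> //; exists 0; rewrite subn0.
Qed.

Definition bit N u := N %/ 2 ^ u %% 2.

Lemma dvdn_bit N i : 2 ^ i %| N.+1 -> bit N i = 1 -> 2 ^ i.+1 %| N.+1.
Proof.
move=> d b; have p0 : 0 < 2 ^ i by rewrite expn_gt0.
have h : N.+1 %/ 2 ^ i = (N %/ 2 ^ i).+1 by rewrite divnS // d add1n.
rewrite -(divnK d) h expnS dvdn_pmul2r // /dvdn -addn1 -modnDml.
by rewrite -/(bit N i) b.
Qed.

(** Carry propagation when [N] ends in exactly [i] ones. Divisibility of [N.+1] by [2 ^ u] tells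
    whether the quotient by [2 ^ u] grows when passing to [N.+1]: it does for [u <= i] and does not
    above. *)
Lemma bit_succ N i : (forall u, u < i -> bit N u = 1) -> 2 ^ i %| N.+1 ->
  bit N i = 0 -> forall u, bit N.+1 u = if u < i then 0 else if u == i then 1 else bit N u.
Proof.
move=> h1 d h0 u; rewrite /bit divnS ?expn_gt0 //.
have le_dvd v : v <= i -> 2 ^ v %| N.+1.
  by move=> vi; apply: dvdn_trans d; apply: dvdn_exp2l.
have nd : ~~ (2 ^ i.+1 %| N.+1).
  rewrite -(divnK d) divnS ?expn_gt0 // d expnS dvdn_pmul2r ?expn_gt0 //.
  by rewrite add1n /dvdn -addn1 -modnDml -/(bit N i) h0.
case: ltngtP => ui.
- by rewrite le_dvd 1?ltnW // add1n -addn1 -modnDml -/(bit N u) h1.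
- rewrite (_ : _ %| _ = false) //; apply: contraNF nd => h.
  by apply: dvdn_trans h; apply: dvdn_exp2l.
- by rewrite ui d add1n -addn1 -modnDml -/(bit N i) h0.
Qed.

Lemma runs_increment N r m : ready2 r -> N.+1 < 2 ^ n ->
  (forall u, u < n -> m u = bit N u) ->
  runs W Q (increment k) r m (20 * n + 20)
    (fun r' m' => [/\ forall y, y \in [:: 0; 1; 6; 13; 16] -> r' y = r y &
       forall u, u < n -> m' u = bit N.+1 u]).
Proof.
move=> [r0 r1 r13 r16] lt hm.
(* The carry stays within the [n] cells, as [2 ^ i] divides [N.+1], which is less than [2 ^ n]. *)
have small i : 2 ^ i %| N.+1 -> i < n.
  by move=> /dvdn_leq h; rewrite -(@ltn_exp2l 2) //; apply: leq_ltn_trans (h _) lt.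
pose I B r' m' := (forall y, y \in [:: 0; 1; 6; 13; 16] -> r' y = r y) /\
  exists i, [/\ r' 2 = i, 2 ^ i %| N.+1, (forall u, u < i -> bit N u = 1),
    r' 7 = bit N i & (forall u, u < n -> m' u = if u < i then 0 else bit N u) /\
    B = (10 * (n - i)).+1].
apply: (@runs_le _ _ _ _ _ _ (5 + ((10 * n).+1 + 1).+1).+1); first by lia.
apply: (runs_seq (Psi := I (10 * n).+1)).
  apply: runs_den => //=; split.
    by move=> y; rewrite !inE => hy; upd_tac.
  exists 0; rewrite subn0 /upd /= mod0n; split=> //.
  by rewrite hm // small.
move=> ra ma Ia.
apply: (runs_seq (Psi := fun r' m' => (forall y, y \in [:: 0; 1; 6; 13; 16] -> r' y = r y) /\
  exists i, [/\ r' 2 = i, 2 ^ i %| N.+1, (forall u, u < i -> bit N u = 1),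
    bit N i = 0 & (forall u, u < n -> m' u = if u < i then 0 else bit N u)])).
  apply: (@runs_while _ _ _ 7 _ I) Ia.
  - move=> B r' m' [fr [i [e2 d b1 e7 [hm' ->]]]] z7; split=> //; split=> //.
    by exists i; split=> //; rewrite -e7.
  - move=> B r' m' [fr [i [e2 d b1 e7 [hm' ->]]]] nz7.
    have b : bit N i = 1.
      by move: nz7; rewrite e7 /bit; case: (_ %% 2) (ltn_pmod (N %/ 2 ^ i) (isT : 0 < 2)) => [|[]].
    have d' := dvdn_bit d b.
    have [lti lti'] := (small _ d, small _ d').
    exists 7, (10 * (n - i.+1)).+1; split; first by nia.
    apply: runs_den => //=; split.
      by move=> y hy; rewrite !(upd_notin _ _ hy) ?fr.
    have e : (r' 2 + r' 1) %% W = i.+1.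
      by rewrite e2 fr // r1 addn1 modn_small //; lia.
    exists i.+1; rewrite /upd /= e; split=> //.
    - by move=> u; rewrite ltnS leq_eqVlt => /predU1P[->|/b1].
    - by rewrite e2 gtn_eqF // hm' // ltnNge leqnSn.
    split=> // u un; rewrite e2 fr // r13 hm' //.
    by case: (ltngtP u i) => ui; rewrite ltnS ?ui ?(ltnW ui) ?leqnn //; case: leqP => //; lia.
move=> rb mb [fr [i [e2 d b1 b0 hm']]].
apply: runs_den => //=; split=> // u un.
rewrite (bit_succ b1 d b0) /upd e2 hm' // fr // r1.
by case: (ltngtP u i).
Qed.

Lemma runs_reset r m : ready2 r ->
  runs W Q (reset k) r m (10 * n + 10)
    (fun r' m' => ready2 r' /\ forall u, u < n -> m' u = 0).
Proof.
move=> rd.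
pose I B r' m' := ready2 r' /\ [/\ r' 2 <= n, r' 6 = (r' 2 < n),
  (forall u, u < r' 2 -> m' u = 0) & B = (8 * (n - r' 2)).+1].
apply: (@runs_le _ _ _ _ _ _ (5 + (8 * n).+1).+1); first by lia.
apply: (runs_seq (Psi := I (8 * n).+1)).
  apply: runs_den => //=; split; first by move: rd => [? ? ? ?]; rewrite /ready2 /upd.
  by move: rd => [h0 _ _ _]; rewrite /upd /= mod0n h0 subn0.
move=> ra ma; apply: (@runs_while _ _ _ 6 _ I).
- move=> B r' m' [rd' [le e6 h ->]] z6; split=> //; split=> // u un; apply: h.
  by move: z6; rewrite e6; case: (ltnP (r' 2) n) => //; lia.
- move=> B r' m' [rd' [le e6 h ->]] nz6.
  have lt : r' 2 < n by move: nz6; rewrite e6; case: (r' 2 < n).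
  move: (rd') => [e0 e1 e13 e16].
  exists 7, (8 * (n - (r' 2).+1)).+1; split; first by nia.
  have e : (r' 2 + 1) %% W = (r' 2).+1 by rewrite addn1 modn_small //; lia.
  apply: runs_den => //=; split; first by rewrite /ready2 /upd.
  rewrite /upd /= e1 e e0; split=> // u; rewrite ltnS leq_eqVlt e13.
  by case: eqP => //= _ /h.
Qed.

End Exhaustive.

(** * Correctness and running time of the program *)

Section WholeProgram.
Variables (k n : nat) (H : {set {set 'I_n}}).
Hypotheses (k2 : 2 <= k) (kH : kgraph k H).
Let k0 : 0 < k := ltnW k2.
Let Q := edge_query H.
Let W := word_bound (coloring_algorithm k) n.
Implicit Types (r m : nat -> nat).

Definition coloring_of m : {ffun 'I_n -> bool} := [ffun v : 'I_n => m v != 0].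

(** With [b = n.+2 ^ (2 * k)], each summand is at most a small multiple of [b], whereas the word
    bound is at least [2 * b ^ 2]. Hence the arithmetic modulo [W] on counters and powers of [n] is
    exact. *)
Lemma word_boundE : tries k n + n + 4 * k + 2 < W.
Proof.
rewrite /W /word_bound /= /tries.
have -> : (4 * k).+1 = 2 * k + (2 * k) + 1 by lia.
rewrite (expnD _ _ 1) (expnD _ (2 * k) (2 * k)) expn1.
have h1 : n ^ (2 * k) <= n.+2 ^ (2 * k) by rewrite leq_exp2r; lia.
have h2 : 2 ^ (2 * k) <= n.+2 ^ (2 * k) by rewrite leq_exp2r; lia.
have h3 : 2 * k < 2 ^ (2 * k) by apply: ltn_expl.
have h4 : n.+2 ^ 2 <= n.+2 ^ (2 * k) by rewrite leq_exp2l; lia.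
have h5 : n %/ (4 * k) <= n by apply: leq_div.
move: (n ^ _) (n.+2 ^ (2 * k)) (n %/ _) (2 ^ _) h1 h2 h3 h4 h5 => a b d e.
rewrite expnS expn1 => h1 h2 h3 h4 h5.
have h6 : 2 * n.+2 <= b by nia.
have h7 : 4 * b <= b * b by rewrite leq_pmul2r; lia.
apply: leq_trans (_ : b * b * 2 <= _); last by rewrite leq_mul2l orbT.
by move: (b * b) h7 => c; lia.
Qed.

Lemma expn_word : n ^ k + 1 < W.
Proof.
have le : n ^ k <= n ^ (2 * k).
  by case: (n) => [|n']; [rewrite !exp0n; lia|apply: leq_pexp2l; lia].
have := word_boundE; rewrite /tries.
by move: (n ^ k) (n ^ (2 * k)) (n %/ (4 * k)) W le => a b d w; lia.
Qed.

(** The digit sequences of the numbers below [n ^ k] are all sequences of [k] vertices, so each edge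
    is met in some order. *)
Lemma violatedE m : (forall u, u < n -> m u <= 1) ->
  has (violated k n Q m) (iota 0 (n ^ k)) = ~~ proper H (coloring_of m).
Proof.
move=> m1; apply/hasP/forall_inPn.
  move=> [t _ /andP[/andP[/allP lt eH] /allP hm]]; eexists; first exact: eH.
  rewrite negbK; apply/existsP; exists (m (t %% n) != 0).
  by apply/forall_inP => v; rewrite inE ffunE => /hm/eqP->.
move=> [e eH]; rewrite negbK => /existsP[b /forall_inP hb].
pose s := [seq val v | v <- enum e].
have sk : size s = k.
  by rewrite size_map -cardE; apply/eqP; apply: (forall_inP kH).
have sn i : i < k -> nth 0 s i < n.
  rewrite -sk => hi; have := mem_nth 0 hi.
  by move=> /mapP[v _ ->]; exact: ltn_ord.
have [t tk ht] := digits_exist sn.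
have es : digit_seq k n t = s.
  apply: (@eq_from_nth _ 0); rewrite size_map size_iota // => i ik.
  by rewrite (nth_map 0) ?size_iota // nth_iota // ht.
exists t; first by rewrite mem_iota.
have ms u : u \in s -> u < n /\ m u = b.
  move=> /mapP[v]; rewrite mem_enum => /hb; rewrite ffunE => /eqP h ->.
  by split=> //; have := m1 v (ltn_ord v); case: (m v) h => [|[]] //= <-.
have tn : t %% n = nth 0 s 0 by rewrite -ht ?expn0 ?divn1; lia.
rewrite /violated es; apply/andP; split.
  apply/andP; split; first by apply/allP => u /ms[].
  rewrite (_ : [set _ | _] = e) //; apply/setP => v; rewrite inE.
  by rewrite mem_map ?mem_enum //; exact: val_inj.
have s0 : nth 0 s 0 \in s by rewrite mem_nth // sk; lia.
by apply/allP => u /ms[_ ->]; rewrite tn; have [_ ->] := ms _ s0.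
Qed.

Definition search_cost := (cost (verify_body k)).+1 + 60.

Lemma runs_search r m : 0 < n -> two_colorable H -> ready2 k n r -> r 6 = 1 ->
  (forall u, u < n -> m u = 0) ->
  runs W Q (While 6 (search_body k)) r m (search_cost * (2 ^ n * n ^ k)).+1
    (fun r' m' => proper H (coloring_of m')).
Proof.
move=> n0 /existsP[c pc] rd r6 m0.
(* The bits of [M] spell out a proper colouring [c], so the counter never has to go beyond [M]. *)
have [|M ltM hM] := @digits_exist 2 n (fun u => color_at c u).
  by move=> i _; case: color_at.
have eM m' : (forall u, u < n -> m' u = bit M u) -> coloring_of m' = c.
  move=> h; apply/ffunP => v; rewrite ffunE h // /bit hM // color_at_ord.
  by case: (c v).
pose I B r' m' := ready2 k n r' /\
  ((exists N, [/\ N <= M, r' 6 = 1, (forall u, u < n -> m' u = bit N u) &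
     B = (search_cost * n ^ k * (2 ^ n - N)).+1]) \/
   [/\ r' 6 = 0, proper H (coloring_of m') & 0 < B]).
apply: (@runs_while _ _ _ 6 _ I).
- by move=> B r' m' [_ [[N [_ -> _ _]]|[_ p B0]]].
- move=> B r' m' [rd' [[N [leN e6 hm ->]]|[e6 p B0]]] nz; last by [].
  have ltN : N < 2 ^ n by lia.
  have le_n : n <= n ^ k by rewrite -[X in X <= _]expn1 leq_pexp2l //; lia.
  exists (7 + (((cost (verify_body k)).+1 * n ^ k).+1 + (20 * n + 20).+1).+1).+1.
  exists (search_cost * n ^ k * (2 ^ n - N.+1)).+1; split.
    rewrite -(subnSK ltN) mulnS /search_cost; nia.
  move: (rd') => [e0 e1 e13 e16].
  apply: (runs_seq (Psi := fun r1 m1 => [/\ m1 = m', ready2 k n r1, r1 3 = 0,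
                       r1 7 = (0 < n ^ k) & r1 12 = 0 /\ r1 6 = 1])).
    apply: runs_den => //=; rewrite /ready2 /upd /= mod0n e13 e16; split=> //.
  move=> r1 m1 [-> rd1 h3 h7 [h12 h6]].
  apply: runs_seq (runs_verify Q k0 word_boundE expn_word m' rd1 h3 h7 h12) _.
  move=> r2 m2 [-> g12 f2]; apply: runs_if.
  have rd2 : ready2 k n r2.
    by apply: ready2_frame rd1 _ => y hy; apply: f2; move: hy; rewrite !inE; lia.
  rewrite g12 violatedE; last by move=> u un; rewrite hm // /bit; lia.
  case: (boolP (proper _ _)) => [p|np] /=.
    apply: (@runs_le _ _ _ _ _ _ 1); first by lia.
    apply: runs_den => //=.
    split; first by move: rd2 => [? ? ? ?]; rewrite /ready2 /upd.
    by right; rewrite /upd /= mod0n.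
  have NM : N < M.
    rewrite ltn_neqAle leN andbT; apply: contraNneq np => e.
    by rewrite (eM m') // -e.
  have lt1 : N.+1 < 2 ^ n by lia.
  apply: runs_post (runs_increment Q k0 word_boundE expn_word rd2 lt1 hm).
  move=> r3 m3 [f3 h3']; split.
    by apply: ready2_frame rd2 _ => y hy; apply: f3; move: hy; rewrite !inE; lia.
  by left; exists N.+1; split=> //; rewrite f3 // f2 // h6.
- split=> //; left; exists 0; split=> //.
    by move=> u un; rewrite m0 // /bit div0n mod0n.
  by rewrite subn0 -mulnA [n ^ k * _]mulnC.
Qed.

Definition exhaustive_cost := search_cost + 40.

Lemma runs_exhaustive r m : 0 < n -> two_colorable H -> ready2 k n r ->
  runs W Q (exhaustive k) r m (exhaustive_cost * (2 ^ n * n ^ k))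
    (fun r' m' => proper H (coloring_of m')).
Proof.
move=> n0 tH rd.
apply: (@runs_le _ _ _ _ _ _
  (10 * n + 10 + (1 + (search_cost * (2 ^ n * n ^ k)).+1).+1).+1).
  rewrite /exhaustive_cost mulnDl.
  have h1 : n < 2 ^ n by apply: ltn_expl.
  have h2 : 0 < n ^ k by rewrite expn_gt0 n0.
  have h3 : 2 ^ n <= 2 ^ n * n ^ k by rewrite leq_pmulr.
  by move: (2 ^ n * n ^ k) h3 => a; lia.
apply: runs_seq (runs_reset Q k0 word_boundE expn_word m rd) _.
move=> r1 m1 [rd1 h1].
apply: (runs_seq (Psi := fun r2 m2 => [/\ ready2 k n r2, r2 6 = 1 &
                                        forall u, u < n -> m2 u = 0])).
  have w1 : 1 < W by have := word_boundE; lia.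
  apply: runs_den => //=; split=> //; by rewrite /upd /= modn_small.
by move=> r2 m2 [rd2 h6 h2]; apply: runs_search.
Qed.

Lemma den_powers x l a r m : x <> 0 -> r 0 = n -> r x = n ^ a -> a + l <= 2 * k ->
  exists r', [/\ den W Q (block (nseq l (@Binop k Mul x x 0))) (r, m) = (r', m),
    r' x = n ^ (a + l) & forall y, y <> x -> r' y = r y].
Proof.
move=> x0; elim: l a r => [|l IH] a r r0 rx le; first by exists r; rewrite addn0.
rewrite den_block_cons /= -/(nseq l _) -/(block _) r0 rx.
set r1 := upd _ _ _.
have r1y y : y <> x -> r1 y = r y by move=> ?; rewrite /r1; upd_tac.
have r1x : r1 x = n ^ a.+1.
  rewrite /r1 /upd eqxx -expnSr modn_small //; have := word_boundE.
  have h : n ^ a.+1 <= n ^ (2 * k) + 1.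
    case: (posnP n) => [->|n0]; first by rewrite exp0n.
    by apply: leq_trans (leq_addr _ _); apply: leq_pexp2l; lia.
  rewrite /tries; move: (n ^ a.+1) (n ^ (2 * k)) (n %/ (4 * k)) W h => b c d w; lia.
have r10 : r1 0 = n by rewrite r1y // => /esym.
have [|r' [e h1 h2]] := IH a.+1 r1 r10 r1x; first by lia.
exists r'; split=> //; first by rewrite h1 addSnnS.
by move=> y ne; rewrite h2 // r1y.
Qed.

Lemma straight_prologue : straight (prologue k).
Proof.
rewrite /prologue straight_block /= !all_cat /= all_nseq orbT /=.
by rewrite all_nseq orbT.
Qed.

Lemma runs_prologue r m : r 0 = n -> (forall y, y <> 0 -> r y = 0) ->
  runs W Q (prologue k) r m (cost (prologue k))
    (fun r' m' => [/\ ready k n r', r' 2 = 0 & r' 6 = (0 < n)]).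
Proof.
move=> r0 rz; have hW := word_boundE.
apply: runs_den; first exact: straight_prologue.
rewrite /prologue den_block_cat.
set s := den _ _ (block [:: _; _; _; _; _; _]) _.
have [ra es [a0 a1 a4 [a5 a13 a14 a16 a2]]] : exists2 ra, s = (ra, m) &
    [/\ ra 0 = n, ra 1 = 1, ra 4 = n %/ (4 * k) &
    [/\ ra 5 = n ^ 0, ra 13 = 0, ra 14 = 2 * k, ra 16 = n ^ 0 & ra 2 = 0]].
  eexists; first by rewrite /s /=; reflexivity.
  by rewrite /upd /= r0 (rz 13) // (rz 2) // !modn_small //; lia.
rewrite es den_block_cat.
have [||||rb [eb b5 fb]] := @den_powers 5 (2 * k) 0 ra m; rewrite ?add0n //.
rewrite eb den_block_cat.
have [||||rc [ec c16 fc]] := @den_powers 16 k 0 rb m; rewrite ?fb //; first by lia.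
rewrite ec /= /ready /upd /= c16 !fc // b5 !fb // a4 a13 a0 !add0n.
split=> //; split=> //; split=> //; rewrite modn_small 1?addnC //.
by move: hW; rewrite /tries; move: (n ^ (2 * k)) (n %/ (4 * k)) W => c d w; lia.
Qed.

Definition step_cost := cost (prologue k) + outer_cost k + exhaustive_cost + 10.

Lemma runs_program : two_colorable H ->
  runs W Q (program k) (upd (fun=> 0) 0 n) (fun=> 0)
    (step_cost * (1 + \sum_(v < n) (num_tries k n Q v).+1 +
                  stuck k n Q * (2 ^ n * n ^ k)))
    (fun _ m' => proper H (coloring_of m')).
Proof.
move=> tH; set S1 := \sum_(v < n) _; set S2 := _ * (_ * _).
apply: (@runs_le _ _ _ _ _ _ (cost (prologue k) + ((outer_cost k * S1).+1 +
          (1 + (exhaustive_cost * S2).+2).+1).+1).+1).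
  by rewrite /step_cost; nia.
apply: runs_seq (runs_prologue (fun=> 0) _ _) _ => //.
  by move=> y ?; upd_tac.
move=> r1 m1 [rd1 h2 h6].
apply: runs_seq (runs_outer Q k0 word_boundE m1 rd1 h2 h6) _.
move=> r2 m2 [rd2 le2 cu st].
apply: (runs_seq (Psi := fun r3 m3 => [/\ m3 = m2, ready2 k n r3 & r3 6 = (r2 2 < n)])).
  move: rd2 => [e0 e1 e4 [e5 e13 e14 e16]].
  by apply: runs_den => //=; rewrite /ready2 /upd /= e0.
move=> r3 m3 [-> rd3 h36]; apply: runs_if; rewrite h36.
case: ltnP => [lt|ge] /=.
  apply: runs_le (runs_exhaustive m2 _ tH rd3); last by lia.
  by rewrite /S2 st // mul1n.
apply: (@runs_le _ _ _ _ _ _ 1) => //; apply: runs_den => //=.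
move/existsP: tH => [c pc].
(* For any proper [c], the certificates make the memory hold [c] or its complement, according to the
   colour of 0; properness is invariant under complement. *)
have cv (v : 'I_n) : (m2 v != 0) = c v (+) color_at c 0.
  have [|_ [x cx]] := cu v; first by have := ltn_ord v; lia.
  by rewrite -(certifies_color k2 pc cx) color_at_ord; case: (c v); case: color_at.
apply/forall_inP => e eH; apply: contra (forall_inP pc e eH).
move=> /existsP[b /forall_inP hb]; apply/existsP; exists (b (+) color_at c 0).
apply/forall_inP => v /hb; rewrite ffunE cv => /eqP <-.
by case: (c v); case: color_at.
Qed.

Lemma program_halts : two_colorable H ->
  exists t s, [/\ reach W Q t (init (coloring_algorithm k) n) s, halted s,
    proper H (output n s) &
    t <= step_cost * (1 + \sum_(v < n) (num_tries k n Q v).+1 +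
                      stuck k n Q * (2 ^ n * n ^ k))].
Proof.
move=> /runs_program[t [r' [m' [le p h]]]].
by exists t, (Config [::] r' m'); split=> //; apply: h.
Qed.

End WholeProgram.

Lemma coloring_algorithm_correct k : 2 <= k -> always_correct (coloring_algorithm k).
Proof.
move=> k2 n H kH tH; have [t [s [h hs p _]]] := program_halts k2 kH tH.
exact: reach_always h hs p.
Qed.

(** * Independent failures *)

(** Independence in counting form, with denominators cleared: a uniform subset of [U] contains no
    [E i] with probability at most [(1 - 2 ^ - q) ^ #|J|]. By induction, [H] splits into its trace
    on one [E i], which must not be full, and the rest, on which the other [E j] live. *)
Lemma card_avoid (T I : finType) (q : nat) (J : {set I}) (U : {set T}) (E : I -> {set T}) :
  {in J, forall i, E i \subset U /\ #|E i| <= q} ->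
  {in J &, forall i j, i != j -> [disjoint E i & E j]} ->
  #|[set H in powerset U | [forall i in J, ~~ (E i \subset H)]]| * (2 ^ q) ^ #|J|
    <= (2 ^ q).-1 ^ #|J| * 2 ^ #|U|.
Proof.
have [m] := ubnP #|J|; elim: m J U => // m IH J U lem hE dE.
have [->|[i iJ]] := set_0Vmem J.
  rewrite cards0 !expn0 muln1 mul1n -card_powerset; apply: subset_leq_card.
  by apply/subsetP => H; rewrite inE => /andP[].
have [EU Eq] := hE i iJ.
set J' := J :\ i; set U' := U :\: E i.
have cJ : #|J| = #|J'|.+1 by rewrite (cardsD1 i) iJ.
have lem' : #|J'| < m by rewrite cJ ltnS in lem.
have hE' : {in J', forall j, E j \subset U' /\ #|E j| <= q}.
  move=> j; rewrite inE => /andP[ji jJ]; have [jU jq] := hE j jJ; split=> //.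
  by rewrite subsetD jU dE // -in_set1.
have dE' : {in J' &, forall j j', j != j' -> [disjoint E j & E j']}.
  by move=> j j'; rewrite !inE => /andP[_ jJ] /andP[_ j'J]; apply: dE.
have le := IH J' U' lem' hE' dE'.
set N' := #|_| in le; set N := #|_|.
pose f (H : {set T}) := (H :&: E i, H :\: E i).
have NN' : N <= (2 ^ #|E i|).-1 * N'.
  have -> : (2 ^ #|E i|).-1 = #|[set A in powerset (E i) | A != E i]|.
    rewrite -card_powerset (cardsD1 (E i) (powerset _)) inE subxx add1n /=.
    by apply: eq_card => A; rewrite !inE andbC.
  rewrite /N' -cardsX /N -[X in X <= _](card_in_imset (f := f)); last first.
    by move=> H1 H2 _ _ [e1 e2]; rewrite -(setID H1 (E i)) e1 e2 setID.
  apply: subset_leq_card; apply/subsetP => _ /imsetP[H + ->].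
  rewrite !inE => /andP[HU /forall_inP av] /=.
  rewrite subsetIr /=; apply/and3P; split.
  - by apply: contra (av i iJ) => /eqP <-; exact: subsetIl.
  - exact: setSD.
  - apply/forall_inP => j; rewrite !inE => /andP[_ jJ].
    by apply: contra (av j jJ) => h; apply: subset_trans h (subsetDl _ _).
have cU : 2 ^ #|U| = 2 ^ #|U'| * 2 ^ #|E i|.
  by rewrite -expnD -[in LHS](cardsID (E i)) (setIidPr EU) addnC.
have le2 : 2 ^ #|E i| <= 2 ^ q by rewrite leq_exp2l.
have p1 : 0 < 2 ^ #|E i| by rewrite expn_gt0.
rewrite cJ !expnS cU.
move: (2 ^ #|E i|) (2 ^ q) (2 ^ #|U'|) NN' le2 p1 le => e Q u NN' le2 p1.
move: (_ ^ _) (_ ^ _) => Y X le.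
have h1 : N * (Q * X) <= e.-1 * Q * (Y * u).
  apply: (@leq_trans (e.-1 * N' * (Q * X))); first by rewrite leq_mul2r NN' orbT.
  by rewrite mulnACA leq_mul2l le orbT.
apply: leq_trans h1 _.
(* The ratio [(e - 1) / e] increases with [e], so smaller sets only fail less often. *)
have h2 : e.-1 * Q <= Q.-1 * e by nia.
by rewrite (mulnC u) [leqRHS]mulnACA leq_mul.
Qed.

(** * Edges required by a certificate *)

Section Tuples.
Variables (k n : nat).
Hypothesis k3 : 3 <= k.
Implicit Types (c : {ffun 'I_n -> bool}) (x : nat -> nat) (v : nat).

Definition vset (s : seq nat) : {set 'I_n} := [set v : 'I_n | (v : nat) \in s].

Lemma card_vset s : uniq s -> all (fun v => v < n) s -> #|vset s| = size s.
Proof.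
move=> us /allP ls; rewrite cardE -(size_map val).
apply/perm_size/uniq_perm => //.
  by rewrite map_inj_uniq ?enum_uniq //; exact: val_inj.
move=> u; apply/mapP/idP => [[i]|us']; first by rewrite mem_enum inE => ? ->.
by exists (Ordinal (ls u us')); rewrite // mem_enum inE.
Qed.

(** For fixed [c] the admissible hypergraphs are the subsets of this set, so a uniform one contains
    its elements independently. *)
Definition bichromatic c : {set {set 'I_n}} :=
  [set e : {set 'I_n} | (#|e| == k) && ~~ monochromatic c e].

Lemma sub_bichromatic (H : {set {set 'I_n}}) c :
  (H \subset bichromatic c) = kgraph k H && proper H c.
Proof.
apply/subsetP/andP => [h|[/forall_inP h1 /forall_inP h2] e eH].
  by split; apply/forall_inP => e /h; rewrite inE => /andP[].
by rewrite inE h1 ?h2.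
Qed.

Definition requests v x b : seq (seq nat) := rcons (anchor_req k x) (vertex_req k v x b).

Definition required c v x : {set {set 'I_n}} :=
  [set e in [seq vset s | s <- requests v x (color_at c v != color_at c 0)]].

Definition num_requests := (size (core_pos k)).+2.

(** A tuple suited to [c]: the lower half has the colour of 0 and the upper half the opposite one.
    Avoiding 0 and [v] keeps the two special edges of size [k]. *)
Definition fits c v x := [/\ forall i, i < 2 * k -> x i < n,
  forall i j, i < 2 * k -> j < 2 * k -> x i = x j -> i = j,
  forall i, i < 2 * k -> x i <> 0 /\ x i <> v &
  forall i, i < 2 * k -> color_at c (x i) = color_at c 0 (+) (k <= i)].

Lemma certified_required (H : {set {set 'I_n}}) c v x : v < n -> fits c v x ->
  required c v x \subset H -> certified k (edge_query H) v x.
Proof.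
move=> vn [xn _ _ _] /subsetP h; set b := color_at c v != color_at c 0.
have n0 : 0 < n by exact: leq_ltn_trans vn.
have q s : s \in requests v x b -> all (fun v => v < n) s -> edge_query H s.
  move=> sr sn; rewrite /edge_query sn; apply: h; rewrite inE.
  by apply/mapP; exists s.
have xa p : {in p, forall i, i < 2 * k} -> all (fun v => v < n) (map x p).
  by move=> hp; apply/allP => _ /mapP[i /hp/xn ? ->].
have ia a : a <= k -> {in iota a k.-1, forall i, i < 2 * k}.
  by move=> ak i; rewrite mem_iota; lia.
have : certifies k (edge_query H) v x b.
  apply/andP; split; last first.
    apply: q; first by rewrite mem_rcons inE eqxx.
    by rewrite /= vn xa //; apply: ia; case: (b).
  apply/allP => s sr; apply: q; first by rewrite mem_rcons inE sr orbT.
  move: sr; rewrite mem_rcons inE => /predU1P[->|/mapP[p pc ->]].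
    by rewrite /= n0 xa //; apply: ia.
  by apply: xa; have [] := core_pos_bound pc.
by rewrite /certified; case: (b) => ->; rewrite ?orbT.
Qed.

(** The last fact is where [3 <= k] matters: the edges through 0 or [v] also contain [k - 1 >= 2]
    vertices of the tuple. *)
Lemma requests_facts c v x s : v < n -> fits c v x ->
  s \in requests v x (color_at c v != color_at c 0) ->
  [/\ size s = k, uniq s, all (fun v => v < n) s,
      exists2 u, u \in s & exists2 w, w \in s & color_at c u != color_at c w &
      {in s, forall u, [\/ u = 0, u = v | exists2 i, i < 2 * k & u = x i]} /\
      exists i j, [/\ i < 2 * k, j < 2 * k, i <> j & x i \in s /\ x j \in s]].
Proof.
move=> vn [xn xi x0 xc]; set b := _ != _ => sr.
have n0 : 0 < n by exact: leq_ltn_trans vn.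
(* Treats the anchor edge, with [u = 0] and [d = false], and the edge of [v], with [d = b], at
   once. *)
have special u a (d : bool) : a = (if d then 0 else k) -> u < n ->
    (u = 0 \/ u = v) -> color_at c u = color_at c 0 (+) d -> s = u :: map x (iota a k.-1) ->
    [/\ size s = k, uniq s, all (fun v => v < n) s,
      exists2 u, u \in s & exists2 w, w \in s & color_at c u != color_at c w &
      {in s, forall u, [\/ u = 0, u = v | exists2 i, i < 2 * k & u = x i]} /\
      exists i j, [/\ i < 2 * k, j < 2 * k, i <> j & x i \in s /\ x j \in s]].
  move=> ea un u0v cu ->.
  have ia i : i \in iota a k.-1 -> i < 2 * k.
    by rewrite ea mem_iota; case: (d); lia.
  have a1 : a \in iota a k.-1 by rewrite mem_iota; lia.
  have a2 : a.+1 \in iota a k.-1 by rewrite mem_iota; lia.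
  split.
  - by rewrite /= size_map size_iota; lia.
  - rewrite /= map_inj_in_uniq ?iota_uniq ?andbT; last first.
      by move=> i j /ia ? /ia ?; apply: xi.
    by apply/mapP => -[i /ia /x0 [h1 h2] e]; case: u0v => ee; move: h1 h2; rewrite -e.
  - by rewrite /= un; apply/allP => _ /mapP[i /ia/xn ? ->].
  - exists u; first by rewrite inE eqxx.
    exists (x a); first by rewrite inE map_f ?orbT.
    rewrite cu xc ?ia // ea; case: (d); rewrite ?leqnn /=.
      by rewrite leqNgt (leq_trans _ k3) //=; case: color_at.
    by case: color_at.
  - split=> [w|].
      rewrite inE => /predU1P[->|/mapP[i /ia hi ->]].
        by case: u0v => ->; [apply: Or31|apply: Or32].
      by apply: Or33; exists i.
    have ne : a <> a.+1 by lia.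
    by exists a, a.+1; rewrite !ia // !inE !map_f ?orbT.
move: sr; rewrite mem_rcons inE => /predU1P[e|].
  apply: (special v _ b) e => //; first by right.
  by rewrite /b; case: (color_at c v); case: color_at.
rewrite mem_rcons inE => /predU1P[e|/mapP[p pc ->]].
  by apply: (special 0 _ false) e => //; [left|rewrite addbF].
have [sp hp] := core_pos_bound pc.
have up : uniq p.
  by move/mapP: pc => [A _ ->]; rewrite map_inj_uniq ?enum_uniq //; exact: val_inj.
split.
- by rewrite size_map.
- by rewrite map_inj_in_uniq // => i j /hp ? /hp ?; apply: xi.
- by apply/allP => _ /mapP[i /hp/xn ? ->].
- move/mapP: pc => [A]; rewrite mem_enum inE => /andP[_ /andP[]].
  move=> /exists_inP[i iA ik] /exists_inP[j jA jk] ->.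
  exists (x i); first by rewrite !map_f // mem_enum.
  exists (x j); first by rewrite !map_f // mem_enum.
  by rewrite !xc // (leqNgt k i) ik jk; case: color_at.
- split; first by move=> _ /mapP[i /hp ? ->]; apply: Or33; exists i.
  have l0 : 0 < size p by rewrite sp; lia.
  have l1 : 1 < size p by rewrite sp; lia.
  exists (nth 0 p 0), (nth 0 p 1); rewrite !hp ?mem_nth //; split=> //.
    by move/eqP; rewrite nth_uniq.
  by rewrite !map_f ?mem_nth.
Qed.

Lemma required_bichromatic c v x : v < n -> fits c v x ->
  required c v x \subset bichromatic c /\ #|required c v x| <= num_requests.
Proof.
move=> vn fx; split; last first.
  rewrite cardsE; apply: leq_trans (card_size _) _.
  by rewrite size_map /requests !size_rcons size_map.
apply/subsetP => e; rewrite inE => /mapP[s sr ->].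
have [sk us sn [u us' [w ws' uw]] _] := requests_facts vn fx sr.
rewrite inE card_vset // sk eqxx; apply: contra uw => /existsP[b /forall_inP hb].
have col y : y \in s -> color_at c y = b.
  move=> ys; have yn := allP sn y ys.
  by have := hb (Ordinal yn); rewrite inE => /(_ ys)/eqP <-; rewrite -color_at_ord.
by rewrite !col.
Qed.

Definition share_two x y := exists i j i' j', [/\ i < 2 * k, j < 2 * k, i' < 2 * k,
  j' < 2 * k & i <> j /\ x i = y i' /\ x j = y j'].

(** A common edge contains two vertices of [x]. They differ from 0 and [v], so they must also be
    vertices of [y]. *)
Lemma required_disjoint c v x y : v < n -> fits c v x -> fits c v y ->
  ~ share_two x y -> [disjoint required c v x & required c v y].
Proof.
move=> vn fx fy nsh; rewrite -setI_eq0; apply/eqP/setP => e; rewrite !inE.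
apply/negP => /andP[/mapP[s sr ->] /mapP[s' sr' ss']]; apply: nsh.
have [_ _ sn _ [_ [i [j [i2 j2 ij [xis xjs]]]]]] := requests_facts vn fx sr.
have [_ _ _ _ [cov _]] := requests_facts vn fy sr'.
have tr i0 : i0 < 2 * k -> x i0 \in s -> exists2 i', i' < 2 * k & x i0 = y i'.
  move=> h xs; have xn := allP sn _ xs.
  have : Ordinal xn \in vset s' by rewrite -ss' inE.
  rewrite inE => /cov; have [_ _ x0 _] := fx; have [h1 h2] := x0 i0 h.
  by case.
have [i' hi' ei] := tr i i2 xis; have [j' hj' ej] := tr j j2 xjs.
by exists i, j, i', j'.
Qed.

Lemma card_uncertified (I : finType) (J : {set I}) (X : I -> nat -> nat) c v : v < n ->
  {in J, forall i, fits c v (X i)} ->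
  {in J &, forall i j, i != j -> ~ share_two (X i) (X j)} ->
  #|[set H in powerset (bichromatic c) |
      [forall i in J, ~~ certified k (edge_query H) v (X i)]]| *
    (2 ^ num_requests) ^ #|J| <= (2 ^ num_requests).-1 ^ #|J| * 2 ^ #|bichromatic c|.
Proof.
move=> vn fX sX; pose E i := required c v (X i).
apply: leq_trans (card_avoid (E := E) _ _); last 2 first.
- by move=> i iJ; apply: required_bichromatic; last exact: fX.
- by move=> i j iJ jJ ij; apply: required_disjoint; [| exact: fX|exact: fX|exact: sX].
rewrite leq_mul2r; apply/orP; right; apply: subset_leq_card.
apply/subsetP => H; rewrite !inE => /andP[-> /forall_inP h] /=.
apply/forall_inP => i iJ; apply: contra (h i iJ).
by apply: certified_required => //; exact: fX.
Qed.

End Tuples.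

(** * Comparison with uniform colourings *)

(** The number of monochromatic [k]-sets if one colour class has [a] vertices; see
    [card_bichromatic]. *)
Definition mono_count k n a : nat := 'C(a, k) + 'C(n - a, k).

(** By Pascal's rule, moving a vertex into the larger class creates ['C(a, k - 1)] monochromatic
    sets and destroys ['C(n - a - 1, k - 1)], which is at most ['C(a - 1, k - 1)]. *)
Lemma mono_count_step k n a : 2 <= k -> n <= 2 * a -> a < n ->
  mono_count k n a + 'C(a.-1, k - 2) <= mono_count k n a.+1.
Proof.
case: k => [|[|k]] // _ le lt; rewrite /mono_count (_ : k.+2 - 2 = k) ?subn2 //.
rewrite -(subnSK lt) !binS.
have -> : 'C(a, k.+1) = 'C(a.-1, k.+1) + 'C(a.-1, k).
  by rewrite -binS prednK //; lia.
have : 'C(n - a.+1, k.+1) <= 'C(a.-1, k.+1) by apply: leq_bin2l; lia.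
lia.
Qed.

Lemma mono_count_sym k n a : a <= n -> mono_count k n (n - a) = mono_count k n a.
Proof. by move=> an; rewrite /mono_count subKn // addnC. Qed.

Lemma mono_count_dev k n a : 2 <= k -> a <= n ->
  mono_count k n (uphalf n) + (maxn a (n - a) - uphalf n) * 'C((uphalf n).-1, k - 2)
    <= mono_count k n a.
Proof.
move=> k2; wlog le : a / n - a <= a.
  move=> hw an; have [le|gt] := orP (leq_total (n - a) a); first exact: hw le an.
  have := hw (n - a); rewrite subKn // mono_count_sym // maxnC; apply; lia.
rewrite (maxn_idPl le); have : uphalf n <= a by lia.
set h := uphalf n => ha an.
have hn : n <= 2 * h by rewrite /h; lia.
rewrite -(subnKC ha) addKn; have : h + (a - h) <= n by lia.
elim: (a - h) => [|d IH] hd; first by rewrite mul0n !addn0.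
rewrite addnS; apply: leq_trans (mono_count_step k2 _ _); [|lia|lia].
have := IH (leq_trans _ hd); rewrite addnS => /(_ (leqnSn _)) {}IH.
have : 'C(h.-1, k - 2) <= 'C((h + d).-1, k - 2) by apply: leq_bin2l; lia.
rewrite mulSn; lia.
Qed.

Lemma card_bichromatic k n (A : {set 'I_n}) : 0 < k ->
  #|bichromatic k [ffun v => v \in A]| + mono_count k n #|A| = 'C(n, k).
Proof.
move=> k0; pose D (B : {set 'I_n}) := [set e : {set 'I_n} | e \subset B & #|e| == k].
have cA : n - #|A| = #|~: A| by rewrite [RHS]cardsCs setCK card_ord.
rewrite /mono_count cA -!cards_draws -/(D A) -/(D (~: A)).
have dj : D A :&: D (~: A) = set0.
  apply/setP => e; rewrite !inE; apply/negP => /andP[/andP[eA /eqP ek] /andP[eC _]].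
  have : e \subset A :&: ~: A by rewrite subsetI eA.
  by rewrite setICr subset0 -cards_eq0 ek; lia.
have -> : #|D A| + #|D (~: A)| = #|D A :|: D (~: A)| by rewrite cardsU dj cards0 subn0.
have -> : 'C(n, k) = #|D [set: 'I_n]| by rewrite cards_draws cardsT card_ord.
rewrite -(cardsID (D A :|: D (~: A)) (D setT)) addnC; congr (_ + _).
  apply: eq_card => e; rewrite !inE subsetT /=.
  by case: (#|e| == k); rewrite ?andbF ?andbT.
apply: eq_card => e; rewrite !inE subsetT /=.
case ek: (#|e| == k); rewrite ?andbF ?andbT //=; congr negb.
apply/existsP/orP => [[[] /forall_inP h]|[/subsetP h|/subsetP h]].
- by left; apply/subsetP => v /h; rewrite ffunE => /eqP.
- by right; apply/subsetP => v /h; rewrite ffunE inE => /eqP ->.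
- by exists true; apply/forall_inP => v /h; rewrite ffunE => ->.
- by exists false; apply/forall_inP => v /h; rewrite ffunE inE => /negbTE ->.
Qed.

Definition central n : nat := 'C(n, n./2).

Lemma leq_central n m : 'C(n, m) <= central n.
Proof.
have up a : a < n./2 -> 'C(n, a) <= 'C(n, a.+1).
  by move=> lt; rewrite -(@leq_pmul2l a.+1) // mul_bin_left leq_mul2r; apply/orP; right; lia.
have low a : a <= n./2 -> 'C(n, a) <= central n.
  move=> le; rewrite /central -(subnKC le).
  have : a + (n./2 - a) <= n./2 by lia.
  elim: (n./2 - a) => [|d IH] hd; first by rewrite addn0.
  by apply: leq_trans (IH _) _; [lia|rewrite addnS; apply: up; lia].
have [le|gt] := leqP m n; last by rewrite bin_small.
have [?|?] := leqP m n./2; first exact: low.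
by rewrite -bin_sub //; apply: low; lia.
Qed.

(* [central n / 2 ^ n] decreases only like [n ^ (-1/2)]. *)
Lemma central_step n :
  4 * central n ^ 2 * uphalf n <= central n.+1 ^ 2 * uphalf n.+1.
Proof.
rewrite /central; have [m [->|->]] : exists m, n = m.*2 \/ n = m.*2.+1.
  by exists n./2; have := odd_double_half n; case: (odd n) => /= e; [right|left]; lia.
- have -> : uphalf m.*2 = m by lia.
  have -> : m.*2./2 = m by lia.
  have -> : m.*2.+1./2 = m by lia.
  have -> : uphalf m.*2.+1 = m.+1 by lia.
  have e : m.+1 * 'C(m.*2.+1, m) = m.*2.+1 * 'C(m.*2, m).
    rewrite -[in LHS]bin_sub; last by lia.
    by rewrite (_ : m.*2.+1 - m = m.+1) -?mul_bin_diag //; lia.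
  rewrite -(@leq_pmul2r m.+1) // -mulnA -[leqRHS]mulnA.
  have -> : 'C(m.*2.+1, m) ^ 2 * (m.+1 * m.+1) = (m.*2.+1 * 'C(m.*2, m)) ^ 2.
    by rewrite -e expnMn mulnC expnS expn1.
  by rewrite expnMn; move: ('C(_, _) ^ 2) => X; nia.
- have -> : uphalf m.*2.+1 = m.+1 by lia.
  have -> : m.*2.+1./2 = m by lia.
  have -> : m.*2.+2./2 = m.+1 by lia.
  have -> : uphalf m.*2.+2 = m.+1 by lia.
  rewrite binS (_ : 'C(m.*2.+1, m.+1) = 'C(m.*2.+1, m)); last first.
    by rewrite -bin_sub; [congr 'C(_, _)|]; lia.
  by move: ('C(_, _)) => X; nia.
Qed.

(** By [central_step] the quantity [central m ^ 2 * uphalf m / 4 ^ m] does not decrease in [m]. The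
    factor 4 allowed between the two [uphalf] terms becomes 2 after taking roots. *)
Lemma central_compare n s : s <= n -> uphalf n <= 4 * uphalf (n - s) ->
  0 < uphalf (n - s) -> central (n - s) * 2 ^ s <= 2 * central n.
Proof.
move=> sn le p0.
have : (4 ^ s) * central (n - s) ^ 2 * uphalf (n - s) <= central n ^ 2 * uphalf n.
  rewrite -{3 4}(subnK sn) [n - s + s]addnC; elim: s {sn le p0} (n - s) => [|s IH] m.
    by rewrite expn0 mul1n.
  have h := central_step (s + m); rewrite addSn expnS; apply: leq_trans h.
  by rewrite -!(mulnA 4) leq_mul2l IH.
move: (central _) (central _) (uphalf _) (uphalf _) le p0 => a b u' u le p0 h.
rewrite -leq_sqr !expnMn -expnM mulnC [s * 2]mulnC expnM.
have : 4 ^ s * b ^ 2 * u' <= 4 * a ^ 2 * u'.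
  apply: leq_trans h _; nia.
by rewrite leq_pmul2r.
Qed.

Local Open Scope ring_scope.

(** * Concentration of the weights on balanced colourings *)

Section Domination.
Variable R : realFieldType.

Lemma geometric_shift (x : R) m N : (1 - x) * (\sum_(a < N | (m <= a)%N) x ^+ (a - m)) = 1 - x ^+ (N - m).
Proof.
elim: N => [|N IH]; first by rewrite big_ord0 mulr0 sub0n expr0 subrr.
rewrite big_mkcond big_ord_recr -big_mkcond /= mulrDr IH.
case: leqP => h; first by rewrite subSn // exprS; ring.
by rewrite mulr0 addr0; congr (1 - _ ^+ _); lia.
Qed.

(** The number of hypergraphs properly coloured by a colouring with [a] vertices in one class, by
    [size_weightE]. *)
Definition size_weight k n a : R := 2 ^+ 'C(n, k) / 2 ^+ mono_count k n a.

Lemma size_weight_gt0 k n a : 0 < size_weight k n a.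
Proof. by rewrite divr_gt0 ?exprn_gt0. Qed.

Lemma size_weight_ge0 k n a : 0 <= size_weight k n a.
Proof. exact/ltW/size_weight_gt0. Qed.

Lemma size_weightE k n (A : {set 'I_n}) : (0 < k)%N ->
  2 ^+ #|bichromatic k [ffun v => v \in A]| = size_weight k n #|A|.
Proof.
by move=> k0; rewrite /size_weight -(card_bichromatic A k0) exprD mulfK // expf_neq0.
Qed.

Lemma size_weight_dev k n a : (2 <= k)%N -> (a <= n)%N ->
  size_weight k n a <=
  size_weight k n (uphalf n) *
    (2^-1) ^+ ((maxn a (n - a) - uphalf n) * 'C((uphalf n).-1, k - 2)).
Proof.
move=> k2 an; rewrite /size_weight -mulrA ler_pM2l ?exprn_gt0 //.
rewrite exprVn -invfM -exprD lef_pV2 ?posrE ?exprn_gt0 //.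
rewrite ler_eXn2l ?ltr1n //; exact: mono_count_dev.
Qed.

(** The weights at least halve with every vertex of deviation from balance, so each of the two sides
    contributes at most twice the balanced weight. *)
Lemma sum_size_weight k n : (2 <= k)%N -> (k <= (uphalf n).+1)%N ->
  \sum_(a < n.+1) size_weight k n a <= 4 * size_weight k n (uphalf n).
Proof.
move=> k2 kn; set g := size_weight k n; set h := uphalf n.
have D1 : (0 < 'C(h.-1, k - 2))%N by rewrite bin_gt0; lia.
pose x : R := 2^-1.
have x01 : 0 <= x <= 1 by rewrite /x; apply/andP; split; lra.
have s1 : \sum_(a < n.+1 | (h <= a)%N) x ^+ (a - h) <= 2.
  have := geometric_shift x h n.+1; have : 0 <= x ^+ (n.+1 - h).
    by rewrite exprn_ge0 //; case/andP: x01.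
  by rewrite /x; lra.
have s2 : \sum_(a < n.+1 | (h <= n - a)%N) x ^+ (n - a - h) <= 2.
  rewrite (reindex_inj rev_ord_inj) /=; apply: le_trans s1.
  rewrite le_eqVlt; apply/orP; left; apply/eqP; apply: eq_big => a; have := ltn_ord a.
    by move=> ?; congr (_ <= _)%N; lia.
  by move=> ? _; congr (_ ^+ _); lia.
apply: (@le_trans _ _ (g h * (\sum_(a < n.+1 | (h <= a)%N) x ^+ (a - h) +
          \sum_(a < n.+1 | (h <= n - a)%N) x ^+ (n - a - h)))); last first.
  rewrite mulrC ler_wpM2r ?size_weight_ge0 //.
  by apply: le_trans (lerD s1 s2) _; lra.
rewrite [X in _ * (X + _)]big_mkcond [X in _ * (_ + X)]big_mkcond -big_split mulr_sumr /=.
apply: ler_sum => a _; have an : (a <= n)%N by rewrite -ltnS.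
apply: le_trans (size_weight_dev k2 an) _.
rewrite ler_wpM2l ?size_weight_ge0 // -/h -/x.
have le m : x ^+ (m * 'C(h.-1, k - 2)) <= x ^+ m.
  by apply: ler_wiXn2l; rewrite ?leq_pmulr //; case/andP: x01.
have p m : 0 <= x ^+ m by rewrite exprn_ge0 //; case/andP: x01.
apply: le_trans (le _) _.
have [e|e] := orP (leq_total (n - a) a).
  rewrite (maxn_idPl e) (_ : h <= a)%N; last by rewrite /h; lia.
  by rewrite lerDl; case: ifP.
rewrite (maxn_idPr e) (_ : h <= n - a)%N; last by rewrite /h; lia.
by rewrite lerDr; case: ifP.
Qed.

Lemma sum_split_set (T : finType) (S : {set T}) (F : {set T} -> R) :
  \sum_A F A = \sum_(D in powerset S) \sum_(B in powerset (~: S)) F (D :|: B).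
Proof.
rewrite pair_big /= (reindex_onto (fun p : {set T} * {set T} => p.1 :|: p.2)
  (fun A => (A :&: S, A :&: ~: S))) /=.
  apply: eq_bigl => -[D B] /=; rewrite !inE /=.
  apply/eqP/andP => [[<- <-]|[DS BS]]; first by rewrite !subsetIr.
  congr pair; rewrite setIUl.
    rewrite (setIidPl DS) (_ : B :&: S = set0) ?setU0 //.
    by apply/eqP; rewrite setI_eq0 disjoints_subset.
  rewrite (setIidPl BS) (_ : D :&: ~: S = set0) ?set0U //.
  by apply/eqP; rewrite setI_eq0 disjoints_subset setCK.
by move=> A _; rewrite -setIUr setUCr setIT.
Qed.

Definition depends_on (T : finType) (S : {set T}) (phi : {set T} -> R) :=
  forall A B, A :&: S = B :&: S -> phi A = phi B.

Lemma depends_on_split (T : finType) (S : {set T}) (phi : {set T} -> R) D B :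
  depends_on S phi -> B \in powerset (~: S) -> phi (D :|: B) = phi D.
Proof.
rewrite inE => dep BS; apply: dep; rewrite setIUl (_ : B :&: S = set0) ?setU0 //.
by apply/eqP; rewrite setI_eq0 disjoints_subset.
Qed.

Lemma sum_depends_on (T : finType) (S : {set T}) (phi : {set T} -> R) :
  depends_on S phi ->
  \sum_A phi A = 2 ^+ (#|T| - #|S|) * \sum_(D in powerset S) phi D.
Proof.
move=> dep; rewrite (sum_split_set S) mulr_sumr; apply: eq_bigr => D _.
rewrite (eq_bigr (fun=> phi D)) => [|B BS]; last exact: depends_on_split dep BS.
have cS : #|~: S| = (#|T| - #|S|)%N by rewrite [LHS]cardsCs setCK.
by rewrite sumr_const card_powerset cS -[_ *+ _]mulr_natl natrX.
Qed.

(** Once the trace on [S] is fixed, the completions to a set of size [a] have a fixed size outside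
    [S], so a central binomial coefficient bounds their number. *)
Lemma sum_size_depends_on n (S : {set 'I_n}) (phi : {set 'I_n} -> R) a :
  depends_on S phi -> (forall A, 0 <= phi A) ->
  \sum_(A : {set 'I_n} | #|A| == a) phi A <=
    (central (n - #|S|))%:R * \sum_(D in powerset S) phi D.
Proof.
move=> dep p0; rewrite big_mkcond (sum_split_set S) mulr_sumr; apply: ler_sum => D DS.
rewrite (eq_bigr (fun B => if #|D :|: B| == a then phi D else 0)); last first.
  by move=> B BS; rewrite (depends_on_split D dep BS).
rewrite -big_mkcondr sumr_const -[_ *+ _]mulr_natl ler_wpM2r // ler_nat.
apply: leq_trans (leq_central _ (a - #|D|)).
have -> : (n - #|S|)%N = #|~: S| by rewrite [RHS]cardsCs setCK card_ord.
rewrite -cards_draws; apply: subset_leq_card; apply/subsetP => B.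
rewrite unfold_in => /andP[]; rewrite !inE => BS /eqP <-; rewrite BS /=.
rewrite cardsU (_ : D :&: B = set0) ?cards0 ?subn0 ?addKn //.
apply/eqP; rewrite setI_eq0 disjoint_sym; apply: disjointWr (_ : D \subset S) _.
  by rewrite inE in DS.
by rewrite disjoints_subset.
Qed.

(* The weights [2 ^ #|bichromatic|] concentrate on the nearly balanced sets, so
   on few coordinates their distribution is comparable to the uniform one. *)
Lemma domination k n (S : {set 'I_n}) (phi : {set 'I_n} -> R) :
  (2 <= k)%N -> (k <= (uphalf n).+1)%N ->
  (uphalf n <= 4 * uphalf (n - #|S|))%N -> (0 < uphalf (n - #|S|))%N ->
  depends_on S phi -> (forall A, 0 <= phi A) ->
  \sum_(A : {set 'I_n}) 2 ^+ #|bichromatic k [ffun v => v \in A]| * phi A <=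
  8 * (\sum_(A : {set 'I_n}) 2 ^+ #|bichromatic k [ffun v => v \in A]|) *
    (\sum_A phi A / 2 ^+ n).
Proof.
move=> k2 kn hS S0 dep p0; have k0 : (0 < k)%N by lia.
set g := size_weight k n; set h := uphalf n; set Phi := \sum_(D in powerset S) phi D.
have Sn : (#|S| <= n)%N by rewrite -[X in (_ <= X)%N]card_ord max_card.
have Phi0 : 0 <= Phi by apply: sumr_ge0.
have eW (A : {set 'I_n}) : 2 ^+ #|bichromatic k [ffun v => v \in A]| = g #|A|.
  exact: size_weightE.
have up : \sum_(A : {set 'I_n}) 2 ^+ #|bichromatic k [ffun v => v \in A]| * phi A <=
    4 * g h * (central (n - #|S|))%:R * Phi.
  rewrite (partition_big (fun A : {set 'I_n} => inord #|A| : 'I_n.+1) predT) //=.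
  apply: (@le_trans _ _ (\sum_(a < n.+1) g a * ((central (n - #|S|))%:R * Phi))).
    apply: ler_sum => a _.
    rewrite (eq_bigl (fun A : {set 'I_n} => #|A| == a)); last first.
      move=> A; rewrite -val_eqE /= inordK // ltnS.
      by rewrite -[X in (_ <= X)%N]card_ord max_card.
    rewrite (eq_bigr (fun A => g a * phi A)) => [|A /eqP <-]; last by rewrite eW.
    rewrite -mulr_sumr ler_wpM2l ?size_weight_ge0 //.
    exact: sum_size_depends_on.
  rewrite -mulr_suml -mulrA ler_wpM2r ?mulr_ge0 //.
  exact: sum_size_weight.
(* For the lower bound the balanced sizes alone suffice. *)
have low : g h * (central n)%:R <=
    \sum_(A : {set 'I_n}) 2 ^+ #|bichromatic k [ffun v => v \in A]|.
  rewrite (bigID (fun A : {set 'I_n} => #|A| == h)) /= -[leLHS]addr0 lerD //; last first.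
    by apply: sumr_ge0 => A _; rewrite exprn_ge0.
  rewrite (eq_bigr (fun A => g h)) => [|A /eqP <-]; last exact: eW.
  rewrite sumr_const -[leRHS]mulr_natr ler_wpM2l ?size_weight_ge0 // ler_nat.
  rewrite /central -bin_sub; last by lia.
  rewrite (_ : n - n./2 = h)%N; last by rewrite /h; lia.
  rewrite -[X in 'C(X, _)]card_ord -cardsT -cards_draws; apply: subset_leq_card.
  by apply/subsetP => A; rewrite !inE => /andP[].
apply: le_trans up _; rewrite -mulr_suml (sum_depends_on dep) card_ord -/Phi.
set P := \sum_A _ in low *.
have -> : 2 ^+ (n - #|S|) * Phi / 2 ^+ n = Phi / 2 ^+ #|S|.
  rewrite -[in 2 ^+ n](subnK Sn) exprD.
  have a0 m : 2 ^+ m != 0 :> R by rewrite expf_neq0.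
  move: (2 ^+ _) (2 ^+ _) (a0 (n - #|S|)%N) (a0 #|S|) => a b ha hb.
  by field; rewrite ha hb.
(* The constant 8 is the 4 of [sum_size_weight] times the 2 obtained here. *)
have cc : (central (n - #|S|))%:R * 2 ^+ #|S| <= 2 * (central n)%:R :> R.
  by have := central_compare Sn hS S0; rewrite -(ler_nat R) !natrM natrX.
rewrite mulrA ler_pdivlMr ?exprn_gt0 //.
have g0 : 0 < g h by exact: size_weight_gt0.
have : 4 * g h * ((central (n - #|S|))%:R * 2 ^+ #|S|) * Phi <= 8 * P * Phi.
  rewrite ler_wpM2r //; apply: (@le_trans _ _ (4 * g h * (2 * (central n)%:R))).
    by rewrite ler_wpM2l // mulr_ge0 // ltW.
  by lra.
by apply: le_trans; rewrite le_eqVlt; apply/orP; left; apply/eqP; ring.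
Qed.

End Domination.

Local Close Scope ring_scope.

(** * Blocks *)

Lemma certified_ext k Q v x y : 0 < k -> (forall i, i < 2 * k -> x i = y i) ->
  certified k Q v x = certified k Q v y.
Proof.
move=> k0 xy.
have mp p : {in p, forall i, i < 2 * k} -> map x p = map y p.
  by move=> hp; apply/eq_in_map => i /hp/xy.
have ia a : a <= k -> {in iota a k.-1, forall i, i < 2 * k}.
  by move=> ak i; rewrite mem_iota; lia.
have ea : anchor_req k x = anchor_req k y.
  rewrite /anchor_req (mp _ (ia k (leqnn k))); congr rcons.
  by apply/eq_in_map => p pc; apply: mp; have [] := core_pos_bound pc.
have ev b : vertex_req k v x b = vertex_req k v y b.
  by rewrite /vertex_req mp //; apply: ia; case: (b).
by rewrite /certified /certifies ea !ev.
Qed.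

Lemma tup_block k n i l : i < n %/ (4 * k) -> tup k n i l = (2 * k * i).+1 + l.
Proof. by rewrite /tup => ->. Qed.

Definition set_coloring n (A : {set 'I_n}) : {ffun 'I_n -> bool} := [ffun v => v \in A].

Lemma color_at_set n (A : {set 'I_n}) (v : 'I_n) : color_at (set_coloring A) v = (v \in A).
Proof. by rewrite color_at_ord ffunE. Qed.

Lemma fails_sub k n Q v i j : i <= j -> fails k n Q v j -> fails k n Q v i.
Proof.
move=> ij /allP h; apply/allP => l; rewrite mem_iota => hl; apply: h.
by rewrite mem_iota; lia.
Qed.

(** Once all blocks have failed, all [n ^ (2 * k)] remaining tuples are charged. *)
Lemma num_tries_le k n Q v : num_tries k n Q v <=
  \sum_(j < n %/ (4 * k)) fails k n Q v j +
  n ^ (2 * k) * fails k n Q v (n %/ (4 * k)).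
Proof.
rewrite /num_tries /tries; set J := n %/ _; rewrite big_split_ord /= leq_add2l.
apply: (@leq_trans (\sum_(i < n ^ (2 * k)) fails k n Q v J)).
  apply: leq_sum => i _; case e: (fails k n Q v (J + i)) => //=.
  by rewrite (fails_sub (leq_addr i J) e).
by rewrite sum_nat_const card_ord.
Qed.

Local Open Scope ring_scope.

Section Rates.
Variables (R : realFieldType) (k : nat).
Hypothesis k3 : (3 <= k)%N.

(** [beta] bounds the probability that a suitably coloured tuple is no certificate. A uniform
    colouring suits a block with probability [2 ^ - (2 * k)], which makes [gamma] the corresponding
    bound for a block. *)
Definition beta : R := (2 ^ num_requests k).-1%:R / (2 ^ num_requests k)%:R.
Definition gamma : R := 1 - (1 - beta) / 2 ^+ (2 * k).

Lemma beta_bounds : 0 <= beta /\ beta < 1.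
Proof.
have p0 : (0 < 2 ^ num_requests k)%N by rewrite expn_gt0.
split; first by rewrite divr_ge0.
by rewrite ltr_pdivrMr ?ltr0n // mul1r ltr_nat prednK.
Qed.

Lemma gamma_bounds : 0 < gamma /\ gamma < 1.
Proof.
have [b0 b1] := beta_bounds; rewrite /gamma.
have p1 : 1 < 2 ^+ (2 * k) :> R by rewrite exprn_egt1 ?ltr1n //; lia.
have q0 : 0 < (1 - beta) / 2 ^+ (2 * k).
  by rewrite divr_gt0 ?subr_gt0 // (lt_trans _ p1).
have q1 : (1 - beta) / 2 ^+ (2 * k) < 1.
  by rewrite ltr_pdivrMr ?(lt_trans _ p1) //; lra.
by split; lra.
Qed.

End Rates.

Section Blocks.
Variables (R : realFieldType) (k n v : nat).
Hypotheses (k3 : (3 <= k)%N) (vn : (v < n)%N).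
Implicit Types (A B D : {set 'I_n}).

Local Notation beta := (beta R k).
Local Notation gamma := (gamma R k).

Definition good_block A (i : nat) : bool :=
  [forall l : 'I_(2 * k), color_at (set_coloring A) ((2 * k * i).+1 + l) ==
                          color_at (set_coloring A) 0 (+) (k <= l)%N].

(* The index of the block that may contain [v]. *)
Definition special := (v.-1 %/ (2 * k))%N.

(** The block that may contain [v] counts as a certain failure, since [fits] forbids [v] in the
    tuple. *)
Definition block_factor A (i : nat) : R :=
  if (i != special) && good_block A i then beta else 1.

Definition block_weight j A : R := \prod_(i < j) block_factor A i.

Lemma block_weight_ge0 j A : 0 <= block_weight j A.
Proof.
apply: prodr_ge0 => i _; rewrite /block_factor; case: ifP => // _.
by have [] := beta_bounds R k.
Qed.

(** The good blocks other than the special one are pairwise disjoint, so [card_uncertified] makes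
    each of them contribute a factor [beta]. *)
Lemma card_fails_blocks j A : (j <= n %/ (4 * k))%N ->
  #|[set H in powerset (bichromatic k (set_coloring A)) |
      fails k n (edge_query H) v j]|%:R <=
  2 ^+ #|bichromatic k (set_coloring A)| * block_weight j A.
Proof.
move=> jn; set c := set_coloring A.
have hblk i : (i < j)%N -> (2 * k * i + 2 * k < n)%N.
  move=> ij; have : (i.+1 * (4 * k) <= n)%N.
    by rewrite -leq_divRL; [apply: leq_trans jn|lia].
  by nia.
pose J := [set i : 'I_j | (val i != special) && good_block A i].
have tE (i : 'I_j) l : tup k n i l = ((2 * k * i).+1 + l)%N.
  by apply: tup_block; apply: leq_trans jn.
have fJ : {in J, forall i, fits k c v (tup k n (val i))}.
  move=> i; rewrite inE => /andP[isp /forallP gi].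
  have hi := hblk i (ltn_ord i).
  split=> [l hl|l l' hl hl'|l hl|l hl]; rewrite !tE //.
  - lia.
  - lia.
  - split; first by lia.
    move=> e; move/negP: isp; apply; rewrite /special -e addSn /= mulnC.
    by rewrite divnMDl ?divn_small ?addn0 //; lia.
  - by apply/eqP; have := gi (Ordinal hl).
have sJ : {in J &, forall i i', i != i' ->
    ~ share_two k (tup k n (val i)) (tup k n (val i'))}.
  move=> i i' _ _ ne [l [l2 [l' [l2' [hl _ hl' _ [_ [e _]]]]]]].
  move: e; rewrite !tE => e; case/eqP: ne; apply: val_inj => /=; nia.
have := card_uncertified k3 vn fJ sJ; set Q := (2 ^ num_requests k)%N.
have Q0 : 0 < Q%:R :> R by rewrite ltr0n expn_gt0.
rewrite -(ler_nat R) !natrM (natrX _ Q) (natrX _ Q.-1) (natrX _ 2) => h.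
have -> : block_weight j A = beta ^+ #|J|.
  rewrite /block_weight /block_factor -big_mkcond prodr_const.
  by congr (_ ^+ _); apply: eq_card => i; rewrite !inE.
rewrite /beta -/Q expr_div_n mulrA ler_pdivlMr ?exprn_gt0 // [leRHS]mulrC.
apply: le_trans _ h; rewrite ler_wpM2r ?exprn_ge0 ?(ltW Q0) // ler_nat.
apply: subset_leq_card; apply/subsetP => H; rewrite !inE => /andP[-> /allP hf] /=.
by apply/forall_inP => i _; apply: hf; rewrite mem_iota; exact: ltn_ord.
Qed.

Definition initial_segment m : {set 'I_n} := [set u : 'I_n | (u < m)%N].

Lemma color_at_eq A B u m : A :&: initial_segment m = B :&: initial_segment m ->
  (u < m)%N -> color_at (set_coloring A) u = color_at (set_coloring B) u.
Proof.
move=> e um; rewrite /color_at; case: insubP => // i _ iu; rewrite !ffunE.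
by move/setP: e => /(_ i); rewrite !inE iu um !andbT.
Qed.

Lemma block_weight_depends j :
  depends_on (initial_segment (2 * k * j).+1) (block_weight j).
Proof.
move=> A B e; apply: eq_bigr => i _; rewrite /block_factor; congr (if _ && _ then _ else _).
have hi := ltn_ord i; apply: eq_forallb => l; have hl := ltn_ord l.
by rewrite !(color_at_eq e) //; nia.
Qed.

(** The earlier weight does not depend on the colours of the [2 * k] vertices in block [j], and one
    of the [2 ^ (2 * k)] ways to colour them makes the block good. *)
Lemma block_weight_good j : (2 * k * j + 2 * k < n)%N ->
  \sum_A block_weight j A <=
  2 ^+ (2 * k) * \sum_(A | good_block A j) block_weight j A.
Proof.
move=> jn; pose T := [set u : 'I_n | (2 * k * j < u)%N && (u <= 2 * k * j + 2 * k)%N].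
have cT : #|T| = (2 * k)%N.
  have -> : T = vset n (iota (2 * k * j).+1 (2 * k)).
    by apply/setP => u; rewrite !inE mem_iota addSn ltnS.
  rewrite card_vset ?iota_uniq ?size_iota //.
  by apply/allP => u; rewrite mem_iota; lia.
have dT : depends_on (~: T) (block_weight j).
  move=> A B e; apply: block_weight_depends; apply/setP => u.
  move/setP: e => /(_ u); rewrite !inE; case: (ltnP u (2 * k * j).+1) => h; last by rewrite !andbF.
  by rewrite /= !andbT.
rewrite (sum_depends_on dT) [leRHS]mulrC card_ord [leLHS]mulrC.
have -> : (n - #|~: T|)%N = (2 * k)%N by rewrite cardsCs setCK card_ord cT; lia.
rewrite ler_wpM2r ?exprn_ge0 // [leRHS]big_mkcond (sum_split_set (~: T)).
apply: ler_sum => D DT; rewrite setCK.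
have n0 : (0 < n)%N by lia.
pose z := color_at (set_coloring D) 0.
(* The colouring of the block that is right for the colour [z] of vertex 0. *)
pose B0 := [set u in T | z (+) (k <= u - (2 * k * j).+1)%N].
have B0T : B0 \in powerset T by rewrite inE; apply/subsetP => u; rewrite inE => /andP[].
have memD (u : 'I_n) : u \in D -> u \notin T.
  by move: DT; rewrite inE => /subsetP h /h; rewrite inE.
rewrite (bigD1 B0) //= ifT; last first.
  have e0 : color_at (set_coloring (D :|: B0)) 0 = z.
    rewrite -[0%N]/(val (Ordinal n0)) color_at_set /z -[0%N]/(val (Ordinal n0)).
    by rewrite color_at_set !inE /= orbF.
  apply/forallP => l; rewrite e0; have hl := ltn_ord l.
  have hu : ((2 * k * j).+1 + l < n)%N by lia.
  rewrite -[((2 * k * j).+1 + l)%N]/(val (Ordinal hu)) color_at_set !inE /= addKn.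
  have uT : Ordinal hu \in T by rewrite inE /=; lia.
  have -> : (2 * k * j < (2 * k * j).+1 + l)%N by lia.
  have -> : ((2 * k * j).+1 + l <= 2 * k * j + 2 * k)%N by lia.
  by case uD: (Ordinal hu \in D) => //; move/memD: uD; rewrite uT.
have -> : block_weight j (D :|: B0) = block_weight j D.
  by apply: (depends_on_split D dT); rewrite setCK.
rewrite lerDl; apply: sumr_ge0 => B _.
by case: ifP => // _; exact: block_weight_ge0.
Qed.

(** Each block multiplies the average weight by at most [gamma]; the exponent drops by one when the
    special block is among the first [j]. *)
Lemma sum_block_weight j : (j <= n %/ (4 * k))%N ->
  \sum_A block_weight j A <= 2 ^+ n * gamma ^+ (if (special < j)%N then j.-1 else j).
Proof.
have [g0 g1] := gamma_bounds R k3; have [b0 b1] := beta_bounds R k.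
elim: j => [|j IH] jn.
  rewrite ltn0 expr0 mulr1 (eq_bigr (fun=> 1)) => [|A _]; last by rewrite /block_weight big_ord0.
  rewrite sumr_const -[#|_|]cardsT -powersetT card_powerset cardsT card_ord natrX.
  by [].
have {}IH := IH (ltnW jn).
have e A : block_weight j.+1 A = block_weight j A * block_factor A j.
  by rewrite /block_weight big_ord_recr.
have [js|js] := eqVneq j special.
  rewrite -js ltnSn /=; move: IH; rewrite -js ltnn; apply: le_trans.
  by apply: ler_sum => A _; rewrite e /block_factor -js eqxx mulr1.
have hj : (2 * k * j + 2 * k < n)%N.
  have : (j.+1 * (4 * k) <= n)%N by rewrite -leq_divRL //; lia.
  by nia.
have -> : gamma ^+ (if (special < j.+1)%N then j.+1.-1 else j.+1) =
          gamma * gamma ^+ (if (special < j)%N then j.-1 else j).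
  by rewrite -exprS; congr (_ ^+ _); move: js; rewrite ltnS; case: ltngtP; lia.
rewrite mulrCA; apply: (@le_trans _ _ (gamma * \sum_A block_weight j A)); last first.
  by rewrite ler_wpM2l // ltW.
have -> : \sum_A block_weight j.+1 A =
    \sum_A block_weight j A - (1 - beta) * \sum_(A | good_block A j) block_weight j A.
  rewrite mulr_sumr [X in _ - X]big_mkcond -sumrB; apply: eq_bigr => A _.
  by rewrite e /block_factor js /=; case: ifP => _; ring.
have := block_weight_good hj; set X := \sum_A _; set Y := \sum_(A | _) _ => h.
have hX : X / 2 ^+ (2 * k) <= Y by rewrite ler_pdivrMr ?exprn_gt0 // mulrC.
have d0 : 0 <= 1 - beta by rewrite subr_ge0 ltW.
rewrite /gamma; move: (1 - beta) (_ ^-1) d0 hX => d p d0 hX.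
have : 0 <= d * (Y - X * p) by rewrite mulr_ge0 // subr_ge0.
by lra.
Qed.

Definition total : R := \sum_(A : {set 'I_n}) 2 ^+ #|bichromatic k (set_coloring A)|.

Lemma total_ge0 : 0 <= total.
Proof. by apply: sumr_ge0 => A _; rewrite exprn_ge0. Qed.

(** The first [j] blocks and vertex 0 occupy about half of the vertices at most, so [domination]
    carries the uniform estimate over to the weighted one. *)
Lemma sum_fails_blocks j : (j <= n %/ (4 * k))%N -> (2 * k <= n)%N -> (16 <= n)%N ->
  \sum_(A : {set 'I_n}) #|[set H in powerset (bichromatic k (set_coloring A)) |
      fails k n (edge_query H) v j]|%:R <= 8 * total * gamma ^+ j.-1.
Proof.
move=> jn kn n16; have [g0 g1] := gamma_bounds R k3.
have hj : (4 * k * j <= n)%N by rewrite mulnC -leq_divRL //; lia.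
apply: le_trans (ler_sum _ (fun A _ => card_fails_blocks A jn)) _.
have cS : #|initial_segment (2 * k * j).+1| = (2 * k * j).+1.
  have -> : initial_segment (2 * k * j).+1 = vset n (iota 0 (2 * k * j).+1).
    by apply/setP => u; rewrite [LHS]inE [RHS]inE mem_iota add0n.
  rewrite card_vset ?iota_uniq ?size_iota //.
  by apply/allP => u; rewrite mem_iota; nia.
apply: le_trans (domination (S := initial_segment (2 * k * j).+1) _ _ _ _ _ _) _.
- lia.
- lia.
- rewrite cS; nia.
- rewrite cS; nia.
- exact: block_weight_depends.
- exact: block_weight_ge0.
rewrite ler_wpM2l ?mulr_ge0 ?total_ge0 // -mulr_suml.
rewrite ler_pdivrMr ?exprn_gt0 // mulrC.
apply: le_trans (sum_block_weight jn) _; rewrite ler_wpM2l ?exprn_ge0 //.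
by apply: ler_wiXn2l; rewrite ?ltW //; case: ifP; lia.
Qed.

End Blocks.

Local Close Scope ring_scope.

(** * Lines *)

Lemma slope_inj i j a b a' b' : i <> j -> a * i + b = a' * i + b' ->
  a * j + b = a' * j + b' -> a = a'.
Proof.
wlog le : a b a' b' / a <= a'.
  move=> hw ij e1 e2; have [le|ge] := orP (leq_total a a'); first exact: hw ij e1 e2.
  by apply/esym/(hw a' b' a b) => //; exact: esym.
move=> ij; rewrite -(subnKC le) !mulnDl => e1 e2.
have e : (a' - a) * i = (a' - a) * j by lia.
case: (posnP (a' - a)) => [->|d0]; first by rewrite addn0.
by case: ij; apply/eqP; rewrite -(eqn_pmul2l d0) e.
Qed.

Lemma radix_inj L a y a' y' : y < L -> y' < L -> a * L + y = a' * L + y' ->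
  a = a' /\ y = y'.
Proof.
move=> yL yL' e; have L0 : 0 < L by lia.
have : a = a' by have := congr1 (divn^~ L) e; rewrite !divnMDl // !divn_small // !addn0.
by move=> ea; split=> //; move: e; rewrite ea => /addnI.
Qed.

Section Lines.
Variables (k n v : nat) (c : {ffun 'I_n -> bool}) (M : nat).
Hypotheses (k3 : 3 <= k) (vn : v < n).

Definition relative_class (b : bool) : seq nat :=
  [seq val u | u <- enum [set u : 'I_n | [&& color_at c u == color_at c 0 (+) b,
                                          val u != 0 & val u != v]]].

Hypothesis large : forall b, k * (2 * k * M) <= size (relative_class b).

Lemma relative_classP b u : u \in relative_class b ->
  [/\ u < n, color_at c u = color_at c 0 (+) b, u <> 0 & u <> v].
Proof.
move=> /mapP[w]; rewrite mem_enum inE => /and3P[/eqP h1 /eqP h2 /eqP h3] ->.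
by split=> //; exact: ltn_ord.
Qed.

Lemma relative_class_uniq b : uniq (relative_class b).
Proof. by rewrite map_inj_uniq ?enum_uniq //; exact: val_inj. Qed.

(** Each colour class is cut into [k] columns of length [2 * k * M], so that column [i] has the
    colour prescribed for position [i]. *)
Definition column i y : nat :=
  nth 0 (relative_class (k <= i)) ((if k <= i then i - k else i) * (2 * k * M) + y).

Lemma column_index i y : i < 2 * k -> y < 2 * k * M ->
  (if k <= i then i - k else i) * (2 * k * M) + y < size (relative_class (k <= i)).
Proof.
move=> ik yL; apply: leq_trans (large _).
have hi : (if k <= i then i - k else i) < k by case: (leqP k i) => ?; lia.
move: (if _ then _ else _) (2 * k * M) hi yL => a L hi yL.
have : a.+1 * L <= k * L by rewrite leq_mul2r hi orbT.
by rewrite mulSn; lia.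
Qed.

Lemma column_mem i y : i < 2 * k -> y < 2 * k * M -> column i y \in relative_class (k <= i).
Proof. by move=> ik yL; rewrite mem_nth ?column_index. Qed.

Lemma column_inj i y i' y' : i < 2 * k -> y < 2 * k * M -> i' < 2 * k -> y' < 2 * k * M ->
  column i y = column i' y' -> i = i' /\ y = y'.
Proof.
move=> hi hy hi' hy' e.
have [_ c1 _ _] := relative_classP (column_mem hi hy).
have [_ c2 _ _] := relative_classP (column_mem hi' hy').
have ek : (k <= i) = (k <= i').
  by move: c2; rewrite -e c1; case: color_at; case: (k <= i); case: (k <= i').
have h1 := column_index hi hy; have h2 := column_index hi' hy'.
move: e h1 h2; rewrite /column -ek; set l := relative_class _ => e h1 h2.
move/eqP: e; rewrite nth_uniq ?relative_class_uniq // => /eqP.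
move=> /(radix_inj hy hy')[ei ->]; split=> //; move: ei ek.
by case: (leqP k i) => a1; case: (leqP k i') => a2 //; lia.
Qed.

(* Two distinct lines agree in at most one column. *)
Definition line (p : 'I_M * 'I_M) i : nat := column i (p.1 * i + p.2).

Lemma line_bound (p : 'I_M * 'I_M) i : i < 2 * k -> p.1 * i + p.2 < 2 * k * M.
Proof.
by case: p => [a b] /=; move: (ltn_ord a) (ltn_ord b); move: (val a) (val b) => {}a {}b; nia.
Qed.

Lemma line_fits p : fits k c v (line p).
Proof.
have h i : i < 2 * k -> line p i \in relative_class (k <= i).
  by move=> hi; apply: column_mem => //; exact: line_bound.
split=> [i hi|i j hi hj e|i hi|i hi]; try by case: (relative_classP (h i hi)).
by have [] := column_inj hi (line_bound p hi) hj (line_bound p hj) e.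
Qed.

Lemma line_share p p' : p != p' -> ~ share_two k (line p) (line p').
Proof.
move=> ne [i [j [i' [j' [hi hj hi' hj' [ij [ei ej]]]]]]].
have [e1 e2] := column_inj hi (line_bound p hi) hi' (line_bound p' hi') ei.
have [f1 f2] := column_inj hj (line_bound p hj) hj' (line_bound p' hj') ej.
rewrite -{}e1 in e2; rewrite -{}f1 in f2.
case: p p' ne e2 f2 {ei ej} => [a b] [a' b'] /= /eqP ne e2 f2; apply: ne.
have ea : val a = val a' by exact: slope_inj ij e2 f2.
by congr pair; apply: val_inj => //=; move: e2; rewrite ea => /addnI.
Qed.

Lemma tup_surj (x : nat -> nat) : (forall i, i < 2 * k -> x i < n) ->
  exists2 j, j < tries k n & forall i, i < 2 * k -> tup k n j i = x i.
Proof.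
move=> xn; have [N hN eN] := digits_exist xn.
exists (n %/ (4 * k) + N); first by rewrite /tries ltn_add2l.
by move=> i hi; rewrite /tup ltnNge leq_addr /= addKn eN.
Qed.

(** The [M * M] lines pairwise share at most one vertex, so their required edges are disjoint; by
    [tup_surj] every line is among the tuples tried. *)
Lemma card_fails_lines :
  #|[set H in powerset (bichromatic k c) | fails k n (edge_query H) v (tries k n)]| *
    (2 ^ num_requests k) ^ (M * M) <=
  (2 ^ num_requests k).-1 ^ (M * M) * 2 ^ #|bichromatic k c|.
Proof.
have := @card_uncertified k n k3 _ [set: 'I_M * 'I_M] line c v vn.
rewrite cardsT card_prod card_ord => h.
apply: leq_trans (h _ _); last 2 first.
- by move=> p _; exact: line_fits.
- by move=> p p' _ _; exact: line_share.
rewrite leq_mul2r; apply/orP; right; apply: subset_leq_card.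
apply/subsetP => H; rewrite !inE => /andP[-> /allP hf] /=.
apply/forall_inP => p _; have [xn _ _ _] := line_fits p.
have [j jt ej] := tup_surj xn.
rewrite -(certified_ext _ _ _ ej); last by lia.
by apply: hf; rewrite mem_iota.
Qed.

End Lines.

Lemma card_sum_bool (T : finType) (X : {set T}) (p : pred T) :
  #|[set x in X | p x]| = \sum_(x in X) p x.
Proof.
rewrite -sum1_card big_mkcond [RHS]big_mkcond; apply: eq_bigr => x _.
by rewrite inE; case: (x \in X); case: (p x).
Qed.

Lemma leq_sub_bin m j : 0 < j -> j <= m -> m - j < 'C(m, j).
Proof.
case: j => // j _; elim: m j => // m IH [|j] jm; first by rewrite bin1 subSS subn0.
rewrite binS; have [e|ne] := eqVneq j.+2 m.+1.
  by rewrite e subnn addn_gt0 !bin_gt0; apply/orP; right; lia.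
have h1 : j.+2 <= m by lia.
have := IH j.+1 h1; have : 0 < 'C(m, j.+1) by rewrite bin_gt0; lia.
by rewrite (subSn h1); lia.
Qed.

(** With [m] the quotient of [n] by [2 * k], already [n <= 2 ^ (2 * m)], and [2 * m * k <= n]. *)
Lemma expn_le_exp2 k n : 4 * (k * k) <= n -> 0 < k -> n ^ k <= 2 ^ n.
Proof.
move=> hn k0; set m := n %/ (2 * k).
have h1 : n < 2 * k * m.+1 by rewrite mulnC -ltn_divLR //; lia.
have h2 : m * (2 * k) <= n by apply: leq_divM.
have h3 : 2 * k <= m by rewrite /m leq_divRL; nia.
have h4 : n <= 2 ^ (2 * m).
  rewrite mulnC expnM; have : m < 2 ^ m by exact: ltn_expl.
  by rewrite expnS expn1; move: (2 ^ m) => a; nia.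
apply: (@leq_trans ((2 ^ (2 * m)) ^ k)); first by rewrite leq_exp2r.
by rewrite -expnM leq_exp2l //; nia.
Qed.

Local Open Scope ring_scope.

(** * Rarity of the exhaustive search *)

Section FewStuck.
Variables (R : realFieldType) (k : nat).
Hypothesis k3 : (3 <= k)%N.
Local Notation half := (2^-1 : R).

Lemma pred_ratio_pow Q : (2 <= Q)%N -> (Q.-1%:R / Q%:R) ^+ Q <= half.
Proof.
move=> Q2; set q : R := Q.-1%:R.
have q1 : 1 <= q by rewrite ler1n; lia.
have eQ : Q%:R = q + 1 by rewrite /q natr1 prednK //; lia.
(* (1 + 1/q)^(q+1) >= 1 + (q+1)/q >= 2 by Bernoulli's inequality. *)
have bern m : 1 + m%:R / q <= ((q + 1) / q) ^+ m.
  elim: m => [|m IH]; first by rewrite mul0r addr0 expr0.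
  rewrite exprS -natr1 mulrDl [X in _ <= X]mulrC.
  have q0 : 0 < q by lra.
  have qV : 0 < q^-1 by rewrite invr_gt0.
  have e : (q + 1) / q = 1 + q^-1 by rewrite mulrDl mulfV ?gt_eqF // mul1r.
  rewrite {2}e; apply: le_trans (ler_wpM2r _ IH); last by lra.
  have : 0 <= m%:R / q * q^-1 by rewrite !mulr_ge0 // ltW.
  by lra.
have h := bern Q; have q0 : 0 < q by lra.
have h2 : 2 <= ((q + 1) / q) ^+ Q.
  apply: le_trans h; rewrite eQ mulrDl mulfV ?gt_eqF // mul1r.
  have : 0 < q^-1 by rewrite invr_gt0.
  by lra.
rewrite eQ -[q / (q + 1)]invf_div exprVn lef_pV2 ?posrE //.
by rewrite exprn_gt0 // mulr_gt0 ?invr_gt0 //; lra.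
Qed.

Lemma beta_pow : beta R k ^+ (2 ^ num_requests k) <= half.
Proof. by apply: pred_ratio_pow; rewrite -[2%N]expn1 leq_exp2l. Qed.

(** The last summand makes the lines numerous enough for [card_stuck_balanced]; the others serve
    [expn_le_exp2] and the unbalanced colourings. *)
Definition threshold := (200 + 4 * (k * k) + 32 * k * k * (2 ^ num_requests k * (6 * (32 * k * k))))%N.

Lemma half_expn m : half ^+ m * (2 ^ m)%:R = 1.
Proof. by rewrite natrX -exprMn mulVf ?expr1n. Qed.

Lemma card_stuck_balanced n (A : {set 'I_n}) : (threshold <= n)%N ->
  (n <= 4 * #|A|)%N -> (n <= 4 * (n - #|A|))%N ->
  #|[set H in powerset (bichromatic k (set_coloring A)) | stuck k n (edge_query H)]|%:R
    <= 2 ^+ #|bichromatic k (set_coloring A)| * half ^+ (2 * n).+1.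
Proof.
have bp := beta_pow; have lines := @card_fails_lines k n.
have Q0 : (0 < 2 ^ num_requests k)%N by rewrite expn_gt0.
move: bp lines Q0; rewrite /threshold /beta; set bt := _ / _ => bp lines Q0.
have bE : bt = (2 ^ num_requests k).-1%:R / (2 ^ num_requests k)%:R by [].
have [b0 b1] := beta_bounds R k; rewrite /beta -/bt in b0 b1.
move: bt (2 ^ num_requests k)%N bp lines Q0 bE b0 b1 => bt Q bp lines Q0 bE b0 b1.
move=> nt nA nA'; set c := set_coloring A.
(* With this [M] the [k] columns of length [2 * k * M] need at most [n / 16] vertices, while each
   relative class has at least [n / 4 - 2]. *)
set M := (n %/ (32 * k * k))%N.
have hM : (n < 32 * k * k * M.+1)%N by rewrite mulnC -ltn_divLR //; nia.
have hM2 : (M * (32 * k * k) <= n)%N by apply: leq_divM.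
have hM3 : (Q * (6 * (32 * k * k)) <= M)%N.
  by rewrite /M leq_divRL; [rewrite mulnC; lia|nia].
(* By [beta_pow], this many lines push the failure probability below [2 ^ - (3 * n + 1)]. *)
have MM : (Q * (3 * n).+1 <= M * M)%N.
  have : ((3 * n).+1 <= 6 * (32 * k * k) * M)%N.
    have : (0 < M)%N by nia.
    by move: (32 * k * k)%N hM => d; nia.
  by move=> h; apply: leq_trans (leq_mul (leqnn Q) h) _; rewrite mulnA leq_mul2r hM3 orbT.
have one v : (v < n)%N ->
    #|[set H in powerset (bichromatic k c) | fails k n (edge_query H) v (tries k n)]|%:R
    <= 2 ^+ #|bichromatic k c| * half ^+ (3 * n).+1.
  move=> vn.
  have lg b : (k * (2 * k * M) <= size (relative_class v c b))%N.
    rewrite size_map -cardE.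
    have n0 : (0 < n)%N by lia.
    pose C := [set u : 'I_n | color_at c u == color_at c 0 (+) b].
    have cC : (n <= 4 * #|C|)%N.
      have [e|e] := boolP (color_at c 0 (+) b).
        rewrite (_ : C = A) //; apply/setP => u.
        by rewrite inE color_at_set e; case: (u \in A).
      rewrite (_ : C = ~: A); first by rewrite [#|~: A|]cardsCs setCK card_ord.
      apply/setP => u; rewrite !inE color_at_set (negbTE e).
      by case: (u \in A).
    have : (#|C| <= #|[set u : 'I_n | [&& color_at c u == color_at c 0 (+) b,
              val u != 0 & val u != v]%N]| + 2)%N.
      have sub : C \subset [set u : 'I_n | [&& color_at c u == color_at c 0 (+) b,
              val u != 0 & val u != v]%N] :|: [set Ordinal n0; Ordinal vn].
        apply/subsetP => u; rewrite !inE => -> /=; rewrite -!val_eqE /=.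
        by case: eqP; case: eqP.
      apply: leq_trans (subset_leq_card sub) _; apply: leq_trans (leq_card_setU _ _) _.
      by rewrite leq_add2l cards2; case: (_ != _).
    move: #|_| #|_| cC => x y h1 h2.
    have : (32 * (k * (2 * k * M)) <= 2 * n)%N by nia.
    by lia.
  have := lines _ _ _ k3 vn lg.
  rewrite -(ler_nat R) !natrM (natrX _ _ (M * M)) (natrX _ _ (M * M)) (natrX _ 2) => h.
  have Q0' : 0 < Q%:R :> R by rewrite ltr0n.
  apply: (@le_trans _ _ (2 ^+ #|bichromatic k c| * bt ^+ (M * M))).
    by rewrite bE expr_div_n mulrA ler_pdivlMr ?exprn_gt0 // [leRHS]mulrC.
  rewrite ler_wpM2l ?exprn_ge0 //.
  apply: (@le_trans _ _ (bt ^+ (Q * (3 * n).+1))).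
    by apply: ler_wiXn2l; rewrite // ltW.
  by rewrite exprM lerXn2r ?nnegrE ?exprn_ge0 ?invr_ge0.
rewrite card_sum_bool.
apply: (@le_trans _ _ (\sum_(v < n) #|[set H in powerset (bichromatic k c) |
    fails k n (edge_query H) v (tries k n)]|%:R)).
  rewrite -natr_sum ler_nat (eq_bigr _ (fun v _ => card_sum_bool _ _)) exchange_big /=.
  apply: leq_sum => H _; rewrite /stuck; case: hasP => //= -[v].
  rewrite mem_iota add0n => vn hv.
  by rewrite (bigD1 (Ordinal vn)) //= hv.
apply: (@le_trans _ _ (\sum_(v < n) 2 ^+ #|bichromatic k c| * half ^+ (3 * n).+1)).
  by apply: ler_sum => v _; exact: one.
rewrite sumr_const card_ord -mulrnAr ler_wpM2l ?exprn_ge0 //.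
(* A factor [2 ^ - n] pays for the union bound over the [n] vertices. *)
have -> : (3 * n).+1 = ((2 * n).+1 + n)%N by lia.
rewrite exprD -mulrnAr -[leRHS]mulr1 ler_wpM2l ?exprn_ge0 ?invr_ge0 //.
apply: (@le_trans _ _ (half ^+ n * (2 ^ n)%:R)); last by rewrite half_expn.
rewrite -[leLHS]mulr_natr ler_wpM2l ?exprn_ge0 ?invr_ge0 // ler_nat.
exact/ltnW/ltn_expl.
Qed.

Lemma total_mid n : size_weight R k n (uphalf n) <= total R k n.
Proof.
have cS : #|initial_segment n (uphalf n)| = uphalf n.
  have -> : initial_segment n (uphalf n) = vset n (iota 0 (uphalf n)).
    by apply/setP => u; rewrite [LHS]inE [RHS]inE mem_iota add0n.
  rewrite card_vset ?iota_uniq ?size_iota //.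
  by apply/allP => u; rewrite mem_iota; lia.
rewrite /total (bigD1 (initial_segment n (uphalf n))) //= size_weightE; last by lia.
by rewrite cS lerDl; apply: sumr_ge0 => A _; rewrite exprn_ge0.
Qed.

(** Balanced colourings get stuck with probability at most [2 ^ - (2 * n + 1)]. An unbalanced one
    admits so few hypergraphs that its whole weight is at most [2 ^ - (3 * n + 1)] times the
    balanced weight, which survives summation over [2 ^ n] colourings. Both beat the cost, which is
    at most [4 ^ n]. *)
Lemma few_stuck n : (threshold <= n)%N ->
  (2 ^ n * n ^ k)%:R * (\sum_(A : {set 'I_n})
    #|[set H in powerset (bichromatic k (set_coloring A)) | stuck k n (edge_query H)]|%:R)
  <= total R k n.
Proof.
move=> nt; set g := size_weight R k n (uphalf n).
have n200 : (200 + 4 * (k * k) <= n)%N by apply: leq_trans nt; exact: leq_addr.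
have bnd (A : {set 'I_n}) :
    #|[set H in powerset (bichromatic k (set_coloring A)) | stuck k n (edge_query H)]|%:R
    <= 2 ^+ #|bichromatic k (set_coloring A)| * half ^+ (2 * n).+1 +
       g * half ^+ (3 * n).+1.
  have p1 : 0 <= g * half ^+ (3 * n).+1.
    by rewrite mulr_ge0 ?exprn_ge0 ?invr_ge0 ?size_weight_ge0.
  have p2 : 0 <= 2 ^+ #|bichromatic k (set_coloring A)| * half ^+ (2 * n).+1.
    by rewrite mulr_ge0 ?exprn_ge0 ?invr_ge0.
  have An : (#|A| <= n)%N by rewrite -[X in (_ <= X)%N]card_ord max_card.
  have [/andP[b1 b2]|nb] := boolP ((n <= 4 * #|A|) && (n <= 4 * (n - #|A|)))%N.
    by apply: le_trans (card_stuck_balanced nt b1 b2) _; rewrite lerDl.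
  apply: (@le_trans _ _ (2 ^+ #|bichromatic k (set_coloring A)|)).
    rewrite -(natrX _ 2) ler_nat -card_powerset; apply: subset_leq_card.
    by apply/subsetP => H; rewrite inE => /andP[].
  rewrite [leLHS]size_weightE; last by lia.
  apply: le_trans (size_weight_dev _ _ An) _; first by lia.
  apply: le_trans (_ : _ <= g * half ^+ (3 * n).+1) _; last by rewrite lerDr.
  rewrite ler_wpM2l ?size_weight_ge0 //.
  apply: ler_wiXn2l; rewrite ?invr_ge0 ?invf_le1 ?ler1n //.
  move: n200 nb An {nt p1 p2}; move: #|A| => a n200 nb An.
  (* A deviation of order [n / 4] times a binomial coefficient of at least [n / 4] gives a quadratic
     exponent, hence one above [3 * n]. *)
  have hx : (n - 2 <= 4 * (maxn a (n - a) - uphalf n))%N by move: nb; lia.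
  have hy : (n <= 4 * 'C((uphalf n).-1, k - 2))%N.
    have := @leq_sub_bin (uphalf n).-1 (k - 2); nia.
  by move: (maxn _ _ - _)%N ('C(_, _)) hx hy => x y hx hy; nia.
apply: le_trans (ler_wpM2l _ (ler_sum _ (fun A _ => bnd A))) _; first by [].
rewrite big_split /= -mulr_suml -/(total R k n) sumr_const.
have -> : #|{set 'I_n}| = (2 ^ n)%N.
  by rewrite -cardsT -powersetT card_powerset cardsT card_ord.
have t0 := total_mid n; rewrite -/g in t0.
have g0 : 0 <= g by exact: size_weight_ge0.
have hk : (n ^ k)%:R <= (2 ^ n)%:R :> R.
  by rewrite ler_nat expn_le_exp2 //; lia.
have := half_expn n; set y : R := half ^+ n; set z : R := (2 ^ n)%:R => yz.
have y0 : 0 <= y by rewrite exprn_ge0 ?invr_ge0.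
have z0 : 0 <= z by [].
have -> : half ^+ (2 * n).+1 = half * (y * y) by rewrite exprS mulnC exprM expr2.
have -> : half ^+ (3 * n).+1 = half * (y * y * y).
  by rewrite exprS mulnC exprM -/y; congr (_ * _); rewrite !exprS expr0 mulr1 mulrA.
rewrite natrM -/z -[g * _ *+ _]mulr_natr -/z.
have e : total R k n * (half * (y * y)) + g * (half * (y * y * y)) * z =
    half * (y * y) * (total R k n + g).
  by rewrite [g * _ * z](_ : _ = g * half * (y * y) * (y * z)); [rewrite yz|]; ring.
rewrite e; apply: (@le_trans _ _ (z * z * (half * (y * y) * (total R k n + total R k n)))).
  apply: ler_pM.
  - by rewrite mulr_ge0.
  - by rewrite !mulr_ge0 ?invr_ge0 ?addr_ge0 // (le_trans g0).
  - by rewrite ler_wpM2l.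
  - by rewrite ler_wpM2l ?mulr_ge0 ?invr_ge0 // lerD2l.
have -> : z * z * (half * (y * y) * (total R k n + total R k n)) =
    (y * z) * (y * z) * (2 * half) * total R k n by ring.
by rewrite yz mulfV // !mul1r.
Qed.

End FewStuck.

Local Close Scope ring_scope.

(** * Averaging over pairs *)

Local Open Scope ring_scope.

Lemma eseries_single (R : realType) (f : nat -> \bar R) t :
  (forall u, u != t -> f u = 0%E) -> (\sum_(0 <= u <oo) f u = f t)%E.
Proof.
move=> h; apply: lim_near_cst; first exact: ereal_hausdorff.
near=> N; have tN : (t < N)%N by near: N; exact: nbhs_infty_gt.
rewrite (bigD1_seq t) ?iota_uniq //=; last by rewrite mem_index_iota.
by rewrite big1 ?adde0 // => u /h.
Unshelve. all: by end_near. Qed.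

(** A deterministic halting run puts all mass at one time, so both series have a single nonzero term
    and the infinite summand vanishes. *)
Lemma expected_time_reach (R : realType) k (A : algorithm k) n (H : {set {set 'I_n}}) t s :
  reach (word_bound A n) (edge_query H) t (init A n) s -> halted s ->
  expected_time R A H = (t%:R)%:E.
Proof.
move=> h hs; rewrite /expected_time.
have e u := reach_time_prob R u h hs.
rewrite (@eseries_single _ _ t) ?(@eseries_single _ _ t); last 2 first.
- by move=> u ut; rewrite e (negbTE ut) ?mulr0.
- by move=> u ut; rewrite e (negbTE ut) ?mulr0.
by rewrite e eqxx mulr1 subee // mule0 adde0.
Qed.

Lemma geometric_sum_le (R : realFieldType) (x : R) N : 0 <= x -> x < 1 ->
  \sum_(i < N) x ^+ i <= (1 - x)^-1.
Proof.
move=> x0 x1; have := geometric_shift x 0 N; rewrite (eq_bigr (fun i : 'I_N => x ^+ i)).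
  move=> e; rewrite -[leRHS]mul1r ler_pdivlMr ?subr_gt0 // mulrC e.
  by rewrite lerBlDr lerDl exprn_ge0.
by move=> i _; rewrite subn0.
Qed.

(** With [y] the square root of [x], one factor [y ^+ m] absorbs the power [p] by induction. The
    other absorbs the extra [m], because [m * y ^+ m] is at most the sum of the first [m] powers of
    [y]. *)
Lemma poly_geometric (R : realType) p (x : R) : 0 < x -> x < 1 ->
  exists C, forall m : nat, m%:R ^+ p * x ^+ m <= C.
Proof.
elim: p x => [|p IH] x x0 x1.
  by exists 1 => m; rewrite expr0 mul1r exprn_ile1 // ltW.
have y0 : 0 < Num.sqrt x by rewrite sqrtr_gt0.
have y1 : Num.sqrt x < 1 by rewrite -sqrtr1 ltr_sqrt.
have [C hC] := IH _ y0 y1; exists (C * (1 - Num.sqrt x)^-1) => m.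
rewrite -{1}(sqr_sqrtr (ltW x0)) -exprM mulnC exprM expr2.
have -> : forall a b : R, a ^+ p.+1 * (b * b) = (a ^+ p * b) * (a * b).
  by move=> a b; rewrite exprS; ring.
apply: ler_pM; [by rewrite mulr_ge0 ?exprn_ge0|by rewrite mulr_ge0 ?exprn_ge0|exact: hC|].
apply: le_trans (geometric_sum_le m (ltW y0) y1).
rewrite mulr_natl -[m in _ *+ m]card_ord -sumr_const; apply: ler_sum => i _.
by apply: ler_wiXn2l; [exact: ltW|exact: ltW|exact: ltnW].
Qed.

Lemma poly_geometric_div (R : realType) p d (x : R) : (0 < d)%N -> 0 < x -> x < 1 ->
  exists C, forall n : nat, n%:R ^+ p * x ^+ (n %/ d).-1 <= C.
Proof.
move=> d0 x0 x1; have [C hC] := poly_geometric p x0 x1.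
(* Rounding and the predecessor give [n <= d * m.+2]; the shift by 2 is paid for by the division by
   [x ^+ 2]. *)
exists (d%:R ^+ p * (C / x ^+ 2)) => n; set m := (n %/ d).-1.
have le : (n <= d * m.+2)%N.
  have : (n < d * (n %/ d).+1)%N by rewrite mulnC -ltn_divLR.
  move=> h; apply: leq_trans (ltnW h) _; rewrite leq_mul2l; apply/orP; right; rewrite /m; lia.
apply: (@le_trans _ _ ((d * m.+2)%:R ^+ p * x ^+ m)).
  by rewrite ler_wpM2r ?exprn_ge0 ?(ltW x0) // lerXn2r ?nnegrE // ler_nat.
rewrite natrM exprMn -mulrA ler_wpM2l ?exprn_ge0 // ler_pdivlMr ?exprn_gt0 //.
by rewrite -mulrA -exprD addn2.
Qed.

(** * From pairs to 2-colourable hypergraphs *)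

Section Average.
Variables (R : realType) (k : nat).
Hypothesis k3 : (3 <= k)%N.

Definition colorable n := [set H : {set {set 'I_n}} | kgraph k H && two_colorable H].

Definition pair_sum n (F : {set {set 'I_n}} -> R) : R :=
  \sum_(A : {set 'I_n}) \sum_(H in powerset (bichromatic k (set_coloring A))) F H.

Lemma pair_sum_card n (p : pred {set {set 'I_n}}) :
  pair_sum (fun H => (p H)%:R) = \sum_(A : {set 'I_n})
    #|[set H in powerset (bichromatic k (set_coloring A)) | p H]|%:R.
Proof. by apply: eq_bigr => A _; rewrite card_sum_bool natr_sum. Qed.

Lemma pair_sum_const n a : pair_sum (fun _ : {set {set 'I_n}} => a) = a * total R k n.
Proof.
rewrite /pair_sum /total mulr_sumr; apply: eq_bigr => A _.
by rewrite sumr_const card_powerset -[LHS]mulr_natr natrX.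
Qed.

Lemma pair_sumD n (F G : {set {set 'I_n}} -> R) :
  pair_sum (fun H => F H + G H) = pair_sum F + pair_sum G.
Proof. by rewrite /pair_sum -big_split; apply: eq_bigr => A _; rewrite big_split. Qed.

Lemma pair_sumZ n a (F : {set {set 'I_n}} -> R) :
  pair_sum (fun H => a * F H) = a * pair_sum F.
Proof. by rewrite /pair_sum mulr_sumr; apply: eq_bigr => A _; rewrite mulr_sumr. Qed.

Lemma pair_sum_sum n (I : finType) (F : I -> {set {set 'I_n}} -> R) :
  pair_sum (fun H => \sum_i F i H) = \sum_i pair_sum (F i).
Proof.
rewrite /pair_sum exchange_big; apply: eq_bigr => A _.
by rewrite exchange_big.
Qed.

Lemma ler_pair_sum n (F G : {set {set 'I_n}} -> R) :
  (forall H, F H <= G H) -> pair_sum F <= pair_sum G.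
Proof. by move=> h; apply: ler_sum => A _; apply: ler_sum. Qed.

Lemma set_coloring_inverse n (c : {ffun 'I_n -> bool}) : set_coloring [set v | c v] = c.
Proof. by apply/ffunP => v; rewrite ffunE inE. Qed.

Lemma pair_sum_exchange n (F : {set {set 'I_n}} -> R) :
  pair_sum F = \sum_(H : {set {set 'I_n}})
    \sum_(A : {set 'I_n} | H \in powerset (bichromatic k (set_coloring A))) F H.
Proof. by rewrite /pair_sum (exchange_big_dep predT). Qed.

(** Every 2-colourable hypergraph occurs in at least one pair. *)
Lemma colorable_le_pair_sum n (F : {set {set 'I_n}} -> R) : (forall H, 0 <= F H) ->
  \sum_(H in colorable n) F H <= pair_sum F.
Proof.
move=> F0; rewrite pair_sum_exchange big_mkcond; apply: ler_sum => H _.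
case: ifP => [|_]; last by apply: sumr_ge0.
rewrite inE => /andP[kH /existsP[c pc]].
rewrite (bigD1 [set v | c v]) /=; first by rewrite lerDl sumr_ge0.
by rewrite inE set_coloring_inverse sub_bichromatic kH.
Qed.

(** Certificates determine all colours relative to vertex 0. *)
Lemma not_stuck_unique n (H : {set {set 'I_n}}) (A B : {set 'I_n}) :
  ~~ stuck k n (edge_query H) ->
  H \subset bichromatic k (set_coloring A) -> H \subset bichromatic k (set_coloring B) ->
  color_at (set_coloring A) 0 = color_at (set_coloring B) 0 -> A = B.
Proof.
move=> /hasPn nst; rewrite !sub_bichromatic => /andP[_ pA] /andP[_ pB] e0.
apply/setP => u; have := nst u; rewrite mem_iota => /(_ (ltn_ord u)) /allPn[j _].
rewrite negbK /certified => cj.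
have [b cb] : exists b, certifies k (edge_query H) u (tup k n j) b.
  by case/orP: cj; [exists false|exists true].
have k2 : (2 <= k)%N by lia.
have := certifies_color k2 pA cb; rewrite -(certifies_color k2 pB cb) e0 !color_at_set.
by case: (u \in A); case: (u \in B); case: color_at.
Qed.

(** A hypergraph that is not stuck occurs in at most two pairs, one for each colour of vertex 0;
    stuck ones are counted separately. *)
Lemma total_le_colorable n : total R k n <=
  2 * #|colorable n|%:R + pair_sum (fun H : {set {set 'I_n}} => (stuck k n (edge_query H))%:R).
Proof.
rewrite -[total R k n]mul1r -pair_sum_const.
apply: (@le_trans _ _ (pair_sum (fun H : {set {set 'I_n}} =>
  (~~ stuck k n (edge_query H))%:R + (stuck k n (edge_query H))%:R))).
  by apply: ler_pair_sum => H; case: stuck; rewrite /= ?addr0 ?add0r.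
rewrite pair_sumD lerD2r pair_sum_exchange mulrC mulr_natl.
rewrite -[_ *+ _]sumr_const [leRHS]big_mkcond; apply: ler_sum => H _.
rewrite sumr_const -[leLHS]mulr_natl.
case st: (stuck _ _ _) => /=; first by rewrite mulr0; case: ifP.
rewrite mulr1.
case: (pickP [pred A : {set 'I_n} | H \in powerset (bichromatic k (set_coloring A))]).
  move=> A0 /= hA0; rewrite ifT; last first.
    move: hA0; rewrite !inE sub_bichromatic => /andP[-> pA].
    by apply/existsP; exists (set_coloring A0).
  rewrite ler_nat -[2%N]card_bool.
  pose f (A : {set 'I_n}) := color_at (set_coloring A) 0.
  rewrite -(card_in_imset (f := f)) ?max_card // => A B.
  rewrite !unfold_in /= => hA hB.
  by apply: (not_stuck_unique (H := H)); rewrite ?st // -powersetE.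
by move=> h0; rewrite eq_card0 //; case: ifP.
Qed.

(** The blocks contribute a geometric series. The enumeration of all tuples is reached with
    probability exponentially small in [n], which compensates the factor [n ^ (2 * k)]. *)
Lemma sum_num_tries : exists2 K : R, 0 <= K & forall n v, (v < n)%N -> (2 * k <= n)%N ->
  (16 <= n)%N ->
  pair_sum (fun H : {set {set 'I_n}} => (num_tries k n (edge_query H) v)%:R) <= K * total R k n.
Proof.
have [g0 g1] := gamma_bounds R k3.
have d0 : (0 < 4 * k)%N by lia.
have [C hC] := poly_geometric_div (2 * k) d0 g0 g1.
set g := gamma R k in g0 g1 hC *.
have C0 : 0 <= C by apply: le_trans (hC 0%N); rewrite mulr_ge0 ?exprn_ge0 ?(ltW g0).
have iv : 0 <= (1 - g)^-1 by rewrite invr_ge0 subr_ge0 ltW.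
exists (8 * (1 + (1 - g)^-1 + C)); first by rewrite mulr_ge0 // !addr_ge0.
move=> n v vn kn n16; set J := (n %/ (4 * k))%N.
pose b j := pair_sum (fun H : {set {set 'I_n}} => (fails k n (edge_query H) v j)%:R).
have hb j : (j <= J)%N -> b j <= 8 * total R k n * g ^+ j.-1.
  by move=> jJ; rewrite /b pair_sum_card; apply: sum_fails_blocks.
have t0 := total_ge0 R k n.
apply: (@le_trans _ _ (\sum_(j < J) b j + n%:R ^+ (2 * k) * b J)).
  rewrite -pair_sum_sum -pair_sumZ -pair_sumD; apply: ler_pair_sum => H.
  by rewrite -natr_sum -natrX -natrM -natrD ler_nat num_tries_le.
have s1 : \sum_(j < J) b j <= 8 * total R k n * (1 + (1 - g)^-1).
  apply: (@le_trans _ _ (\sum_(j < J) 8 * total R k n * g ^+ j.-1)).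
    by apply: ler_sum => j _; apply: hb; exact: ltnW.
  rewrite -mulr_sumr ler_wpM2l ?mulr_ge0 //.
  case: (J) => [|J']; first by rewrite big_ord0 addr_ge0.
  by rewrite big_ord_recl lerD2l; apply: geometric_sum_le; rewrite // (ltW g0).
have s2 : n%:R ^+ (2 * k) * b J <= 8 * total R k n * C.
  apply: le_trans (ler_wpM2l _ (hb J (leqnn J))) _; first by rewrite exprn_ge0.
  by rewrite mulrCA ler_wpM2l ?mulr_ge0.
by apply: le_trans (lerD s1 s2) _; rewrite le_eqVlt; apply/orP; left; apply/eqP; ring.
Qed.

End Average.

(** * The linear bound on the average running time *)

Section Conclusion.
Variables (R : realType) (k : nat).
Hypothesis k3 : (3 <= k)%N.

Definition time_bound n (H : {set {set 'I_n}}) : R :=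
  (step_cost k)%:R * (1 + \sum_(v < n) ((num_tries k n (edge_query H) v)%:R + 1) +
                      (2 ^ n * n ^ k)%:R * (stuck k n (edge_query H))%:R).

Lemma time_bound_ge0 n (H : {set {set 'I_n}}) : 0 <= time_bound H.
Proof.
rewrite mulr_ge0 // !addr_ge0 ?mulr_ge0 //.
by apply: sumr_ge0 => v _; rewrite addr_ge0.
Qed.

Lemma expected_time_le n (H : {set {set 'I_n}}) : H \in colorable k n ->
  (expected_time R (coloring_algorithm k) H <= (time_bound H)%:E)%E.
Proof.
rewrite inE => /andP[kH tH]; have k2 : (2 <= k)%N by lia.
have [t [s [h hs _ le]]] := program_halts k2 kH tH.
rewrite (expected_time_reach R h hs) lee_fin.
apply: (le_trans (y := (step_cost k * (1 + \sum_(v < n) (num_tries k n (edge_query H) v).+1 +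
  stuck k n (edge_query H) * (2 ^ n * n ^ k)))%:R)); first by rewrite ler_nat.
rewrite natrM ler_wpM2l // !natrD (mulnC (stuck _ _ _)) (natrM _ (2 ^ n * n ^ k)).
by rewrite lerD2r lerD2l natr_sum; apply: ler_sum => v _; rewrite natr1.
Qed.

Lemma colorable_gt0 n : (0 < #|colorable k n|)%N.
Proof.
apply/card_gt0P; exists set0; rewrite inE; apply/andP; split.
  by apply/forall_inP => e; rewrite inE.
by apply/existsP; exists [ffun=> true]; apply/forall_inP => e; rewrite inE.
Qed.

Lemma average_time_le n (B : R) :
  \sum_(H in colorable k n) time_bound H <= B * #|colorable k n|%:R ->
  (average_time R (coloring_algorithm k) n <= B%:E)%E.
Proof.
move=> h; rewrite /average_time -/(colorable k n).
have c0 : 0 < #|colorable k n|%:R :> R by rewrite ltr0n colorable_gt0.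
apply: (@le_trans _ _ ((\sum_(H in colorable k n) time_bound H)%:E *
                       (#|colorable k n|%:R^-1)%:E)%E).
  apply: lee_wpmul2r; first by rewrite lee_fin invr_ge0.
  by rewrite -sumEFin; apply: lee_sum => H; exact: expected_time_le.
by rewrite -EFinM lee_fin ler_pdivrMr.
Qed.

Lemma average_time_large : exists C : R, 0 <= C /\ forall n, (threshold k <= n)%N ->
  (average_time R (coloring_algorithm k) n <= (C * n%:R)%:E)%E.
Proof.
have [K K0 hK] := sum_num_tries R k3.
exists (4 * (step_cost k)%:R * (3 + K)); split.
  by rewrite !mulr_ge0 // addr_ge0.
move=> n nt; apply: average_time_le.
have n200 : (200 + 4 * (k * k) <= n)%N by apply: leq_trans nt; exact: leq_addr.
have kn : (2 * k <= n)%N by nia.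
have n16 : (16 <= n)%N by lia.
have t0 := total_ge0 R k n; set T := total R k n in t0 *.
pose st (H : {set {set 'I_n}}) : R := (stuck k n (edge_query H))%:R.
have few : (2 ^ n * n ^ k)%:R * pair_sum k st <= T.
  by rewrite /st pair_sum_card; apply: few_stuck.
have st0 : 0 <= pair_sum k st by apply: sumr_ge0 => A _; apply: sumr_ge0 => H _.
(* The search cost is at least 2, so [few] leaves at most half of all pairs stuck;
   [total_le_colorable] then yields the factor 4 in [T4]. *)
have half_T : 2 * pair_sum k st <= T.
  apply: le_trans few; rewrite ler_wpM2r // ler_nat.
  apply: (@leq_trans (2 ^ n)); first by rewrite -[leqLHS]expn1 leq_exp2l //; lia.
  by rewrite leq_pmulr // expn_gt0; lia.
have T4 : T <= 4 * #|colorable k n|%:R.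
  have := total_le_colorable R k3 n; rewrite -/T => h.
  have := half_T; rewrite /st in h *; lra.
apply: le_trans (colorable_le_pair_sum k (@time_bound_ge0 n)) _.
rewrite /time_bound pair_sumZ !pair_sumD pair_sum_const pair_sumZ pair_sum_sum mul1r -/T.
have s1 : \sum_(v < n) pair_sum k (fun H : {set {set 'I_n}} =>
    (num_tries k n (edge_query H) v)%:R + 1) <= n%:R * ((K + 1) * T).
  rewrite mulr_natl -[n in _ *+ n]card_ord -sumr_const; apply: ler_sum => v _.
  rewrite pair_sumD pair_sum_const mulrDl lerD2r; exact: hK.
have n1 : 1 <= n%:R :> R by rewrite ler1n; lia.
(* The three summands are at most [T], [n * (K + 1) * T] and [T], and [1 <= n] absorbs the two
   single terms. *)
apply: (@le_trans _ _ ((step_cost k)%:R * (n%:R * ((3 + K) * T)))).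
  rewrite ler_wpM2l //.
  apply: le_trans (lerD (lerD (lexx T) s1) few) _.
  have : 0 <= (n%:R - 1) * T by rewrite mulr_ge0 // subr_ge0.
  by lra.
have : 0 <= (step_cost k)%:R * (n%:R * (3 + K)) :> R.
  by rewrite !mulr_ge0 // addr_ge0.
move=> p; have := ler_wpM2l p T4; move: #|_|%:R => c h.
by apply: le_trans (le_trans _ h) _; rewrite le_eqVlt; apply/orP; left; apply/eqP; ring.
Qed.

Definition crude_bound n : nat :=
  step_cost k * (1 + n * (tries k n).+1 + 2 ^ n * n ^ k).

Lemma average_time_crude n :
  (average_time R (coloring_algorithm k) n <= (crude_bound n)%:R%:E)%E.
Proof.
apply: average_time_le; rewrite mulr_natr -sumr_const; apply: ler_sum => H _.
rewrite /time_bound /crude_bound [leRHS]natrM ler_wpM2l // !natrD; apply: lerD; last first.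
  by rewrite -natrM ler_nat; case: stuck; rewrite ?muln1 ?muln0.
rewrite lerD2l natrM mulr_natl -[n in _ *+ n]card_ord -sumr_const.
apply: ler_sum => v _; rewrite natr1 ler_nat ltnS /num_tries.
rewrite -[leqRHS]card_ord -sum1_card; apply: leq_sum => j _.
by case: fails.
Qed.

End Conclusion.

Theorem theorem1p2 (R : realType) (k : nat) (hk : (3 <= k)%N) :
  exists A : algorithm k,
    always_correct A /\
    exists C : R, forall n : nat, (1 <= n)%N ->
      (average_time R A n <= (C * n%:R)%:E)%E.
Proof.
exists (coloring_algorithm k); split; first by apply: coloring_algorithm_correct; lia.
have [C [C0 hC]] := average_time_large R hk.
(* The finitely many [n] below the threshold are covered by adding all their worst-case bounds to
   the constant. *)
exists (C + \sum_(m < threshold k) (crude_bound k m)%:R) => n n1.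
have S0 : 0 <= \sum_(m < threshold k) (crude_bound k m)%:R :> R by apply: sumr_ge0.
have n1' : 1 <= n%:R :> R by rewrite ler1n.
have [le|lt] := leqP (threshold k) n.
  apply: le_trans (hC n le) _; rewrite lee_fin ler_wpM2r //.
  by rewrite lerDl.
apply: le_trans (average_time_crude R hk n) _; rewrite lee_fin.
apply: le_trans (_ : _ <= C + \sum_(m < threshold k) (crude_bound k m)%:R) _.
  rewrite (bigD1 (Ordinal lt)) //= addrCA lerDl addr_ge0 //.
  exact: sumr_ge0.
by rewrite ler_peMr // addr_ge0.
Qed.
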